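(* Let $(S,P)$ be a $\Gamma$-contraction on a Hilbert space $\mathcal{H}$, let $F\in\mathcal{B}(\mathcal{D}_P)$ and $G\in\mathcal{B}(\mathcal{D}_{P^*})$ be the fundamental operators of $(S,P)$ and $(S^*,P^* )$ respectively, and let $(R,U)$ be the $\Gamma$-unitary dilation of $(S,P)$ on $\mathcal{K}=\mathcal{H}\oplus l^2(\mathcal{D}_P)\oplus l^2(\mathcal{D}_{P^*})$ given, for $h\in\mathcal{H}$, $a=(a_0,a_1,\dots)\in l^2(\mathcal{D}_P)$, $b=(b_0,b_1,\dots)\in l^2(\mathcal{D}_{P^*})$, by $$U(h\oplus a\oplus b)=(Ph+D_{P^*}b_0)\oplus(D_Ph-P^*b_0,\,a_0,\,a_1,\,a_2,\dots)\oplus(b_1,b_2,b_3,\dots),$$ $$R(h\oplus a\oplus b)=(Sh+D_{P^*}Gb_0)\oplus(F^*D_Ph+Fa_0-P^*Gb_0,\,F^*a_0+Fa_1,\,F^*a_1+Fa_2,\dots)\oplus(G^*b_0+Gb_1,\,G^*b_1+Gb_2,\dots).$$ (i) If $(\tilde R,U)$ (on $\mathcal{K}$, with the same $U$) is another $\Gamma$-unitary dilation of $(S,P)$, then $\tilde R=R$. (ii) If $(\tilde R,\tilde U)$, on some Hilbert space $\tilde{\mathcal{K}}$ containing $\mathcal{H}$, is another $\Gamma$-unitary dilation of $(S,P)$ where $\tilde U$ is a minimal unitary dilation of $P$, then $(\tilde R,\tilde U)$ is unitarily equivalent to $(R,U)$.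
   Context: Let $\Gamma=\{(z_1+z_2,z_1z_2):|z_1|\le 1,|z_2|\le 1\}$ and $b\Gamma=\{(z_1+z_2,z_1z_2):|z_1|=|z_2|=1\}$. A $\Gamma$-contraction is a commuting pair $(S,P)$ of bounded operators on a Hilbert space with $\|f(S,P)\|\le\sup\{|f(s,p)|:(s,p)\in\Gamma\}$ for every polynomial $f$ in two variables. Then $P$ is a contraction and $(S^*,P^* )$ is also a $\Gamma$-contraction. A $\Gamma$-unitary is a commuting pair $(R,U)$ of bounded normal operators with joint spectrum $\sigma(R,U)\subset b\Gamma$. A $\Gamma$-unitary dilation of $(S,P)$ is a $\Gamma$-unitary $(R,U)$ on a Hilbert space $\mathcal{K}\supset\mathcal{H}$ with $S^mP^n=P_{\mathcal{H}}R^mU^n|_{\mathcal{H}}$ for all integers $m,n\ge 0$, where $P_{\mathcal{H}}$ is the orthogonal projection onto $\mathcal{H}$. For a contraction $P$: $D_P=(I-P^*P)^{1/2}$, $\mathcal{D}_P=\overline{\mathrm{Ran}}\,D_P$, $D_{P^*}=(I-PP^* )^{1/2}$, $\mathcal{D}_{P^*}=\overline{\mathrm{Ran}}\,D_{P^*}$; $l^2(\mathcal{D})=\mathcal{D}\oplus\mathcal{D}\oplus\cdots$. The space $\mathcal{H}$ is embedded in $\mathcal{K}$ by $h\mapsto h\oplus 0\oplus 0$. The fundamental operator of a $\Gamma$-contraction $(S,P)$ is the unique operator $F\in\mathcal{B}(\mathcal{D}_P)$ satisfying $S-S^*P=D_PFD_P$ (it is known that such an $F$ exists and is unique); accordingly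 the fundamental operator $G\in\mathcal{B}(\mathcal{D}_{P^*})$ of $(S^*,P^* )$ is the unique operator with $S^*-SP^*=D_{P^*}GD_{P^*}$. A unitary dilation $\tilde U$ of $P$ on $\tilde{\mathcal{K}}\supset\mathcal{H}$ (i.e. $\tilde U$ unitary with $P^n=P_{\mathcal{H}}\tilde U^n|_{\mathcal{H}}$ for $n\ge0$) is minimal if $\tilde{\mathcal{K}}=\overline{\mathrm{span}}\{\tilde U^nh:h\in\mathcal{H},\,n\in\mathbb{Z}\}$. Pairs $(\tilde R,\tilde U)$ on $\tilde{\mathcal{K}}$ and $(R,U)$ on $\mathcal{K}$ are unitarily equivalent if there is a unitary $W:\tilde{\mathcal{K}}\to\mathcal{K}$ with $W\tilde RW^*=R$ and $W\tilde UW^*=U$. *)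

(* Defs.v *)
From HB Require Import structures.
From mathcomp Require Import all_boot all_order all_algebra.
From mathcomp Require Import complex polyXY sesquilinear ring lra.
From mathcomp Require Import boolp classical_sets functions reals topology normedtype sequences.
Set Implicit Arguments. Unset Strict Implicit. Unset Printing Implicit Defensive.
Import Order.TTheory GRing.Theory Num.Theory.
Import numFieldNormedType.Exports.
Local Open Scope classical_set_scope.
Local Open Scope ring_scope.
Local Open Scope complex_scope.

Local Notation Re := complex.Re.
Local Notation Im := complex.Im.

Section dot_norm.
Variables (C : numClosedFieldType) (U : lmodType C) (form : {dot U for Num.conj}).

Lemma dot_CauchySchwarz u v :
  `|form u v| ^+ 2 <= form u u * form v v.
Proof.
have [->|v0] := eqVneq v 0.
  by rewrite !linear0r normr0 expr0n/= mulr0.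
have vv : form v v != 0 by rewrite dnorm_eq0.
pose a := form u v / form v v.
have ov : form (u - a *: v) v = 0.
  by rewrite linearBl/= linearZl_LR/= divfK ?subrr.
have -> : form u u = form (u - a *: v) (u - a *: v) + `|a| ^+ 2 * form v v.
  rewrite -dnormZ -{1 2}(subrK (a *: v) u) hnormDd//.
  by rewrite linearZr_LR/= ov mulr0.
rewrite mulrDl -mulrA -expr2 -[X in _ <= _ + `|_| ^+ 2 * X ^+ 2]ger0_norm ?dnorm_ge0//.
rewrite -exprMn -normrM divfK// lerDr mulr_ge0 ?dnorm_ge0//.
Qed.

Lemma dot_sqrt_triangle u v :
  sqrtC (form (u + v) (u + v)) <= sqrtC (form u u) + sqrtC (form v v).
Proof.
have s0 w : 0 <= sqrtC (form w w) by rewrite sqrtC_ge0 dnorm_ge0.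
rewrite -(ler_pXn2r (n:=2))// ?nnegrE ?addr_ge0//.
rewrite sqrrD !sqrtCK addrAC dnormD lerD2l.
rewrite -mulr_natr -[X in X <= _](divfK (negbT (pnatr_eq0 C 2))) -/('Re _).
rewrite ler_pM2r ?ltr0n//.
have [CS _] : `|form u v| <= sqrtC (form u u) * sqrtC (form v v) ?= iff
    (`|form u v| == sqrtC (form u u) * sqrtC (form v v)).
  split=> //; rewrite -(ler_pXn2r (n:=2))// ?nnegrE ?mulr_ge0//.
  by rewrite exprMn !sqrtCK dot_CauchySchwarz.
apply: le_trans CS; rewrite -ReE.
exact: (leif_Re_Creal (form u v)).
Qed.

End dot_norm.

(* The inner product is linear in its first argument. *)
HB.mixin Record NormedModule_isHilbert (R : realType) H
    & CompleteNormedModule R[i] H := {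
  inner : {dot H for Num.conj};
  innerE : forall x : H, inner x x = `|x| ^+ 2
}.
#[short(type="hilbertType")]
HB.structure Definition Hilbert (R : realType) :=
  {H of NormedModule_isHilbert R H & CompleteNormedModule R[i] H}.

Notation "''[' x , y ]" := (inner x y) (format "''[' x ,  y ]") : ring_scope.

HB.factory Record Lmodule_isHilbert (R : realType) H & GRing.Lmodule R[i] H := {
  form : H -> H -> R[i];
  form_linear : forall z, linear_for *%R (form^~ z);
  form_conj : forall x y, form x y = ((form y x)^*)%R;
  form_gt0 : forall x, x != 0 -> 0 < form x x;
  form_complete : forall u : nat -> H,
    (forall e : R, 0 < e -> exists N, forall m n, (N <= m)%N -> (N <= n)%N ->
      Re (form (u m - u n) (u m - u n)) < e) ->
    exists l, forall e : R, 0 < e -> exists N, forall n, (N <= n)%N ->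
      Re (form (u n - l) (u n - l)) < e
}.

HB.builders Context R H & Lmodule_isHilbert R H.

Let form_linearr z : linear_for (Num.conj \; *%R) (form z).
Proof.
move=> a x y; rewrite form_conj form_linear rmorphD rmorphM/=.
by rewrite (form_conj z x) (form_conj z y).
Qed.

Let form_hermitian x y : form x y = (-1) ^+ false * Num.conj (form y x).
Proof. by rewrite mul1r form_conj. Qed.

HB.instance Definition _ := @bilinear_isBilinear.Build R[i] H H R[i]
  *%R (Num.conj \; *%R) form (form_linear, form_linearr).
HB.instance Definition _ := @isHermitianSesquilinear.Build R[i] H false Num.conj
  form form_hermitian.
HB.instance Definition _ := @isDotProduct.Build R[i] H form form_gt0.

Let norm (x : H) : R[i] := sqrtC (form x x).

Let normD x y : norm (x + y) <= norm x + norm y.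
Proof. exact: dot_sqrt_triangle. Qed.

Let normZ (l : R[i]) x : norm (l *: x) = `|l| * norm x.
Proof.
by rewrite /norm dnormZ sqrtCM ?nnegrE ?exprn_ge0 ?dnorm_ge0// sqrCK.
Qed.

Let norm0 x : norm x = 0 -> x = 0.
Proof. by move/eqP; rewrite sqrtC_eq0 dnorm_eq0 => /eqP. Qed.

HB.instance Definition _ := Lmodule_isNormed.Build R[i] H normD normZ norm0.

Let formE (x : H) : form x x = `|x| ^+ 2.
Proof. by rewrite sqrtCK. Qed.

Let small (x : H) (e : R) : 0 < e -> (Re (form x x) < e ^+ 2) = (`|x| < e%:C).
Proof.
move=> e0; have eC : 0 <= e%:C by rewrite lecE/= eqxx ltW.
rewrite -[RHS](ltr_pXn2r (n:=2)) ?nnegrE// -formE.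
by rewrite -rmorphXn/= ltcE/= (ger0_Im (dnorm_ge0 _ _)) eqxx.
Qed.

Let complete (F : set_system H) : ProperFilter F -> cauchy F -> cvg F.
Proof.
move=> FF /cauchyP Fc.
have /choice[u Fu] : forall n : nat, exists x : H, F (ball x (n.+1%:R^-1 : R[i])).
  by move=> n; apply: Fc; rewrite invr_gt0 ltr0n.
have uE m n : `|u m - u n| < m.+1%:R^-1 + n.+1%:R^-1.
  have [z [zm zn]] := filter_ex (filterI (Fu m) (Fu n)).
  rewrite -ball_normE/= in zm zn; rewrite -(subrK z (u m)) -addrA.
  by rewrite (le_lt_trans (ler_normD _ _))// ltrD// distrC.
have inv_small (e : R) : 0 < e -> exists N : nat, forall n : nat, (N <= n)%N ->
    (n.+1%:R^-1 : R[i]) < e%:C.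
  move=> e0; exists (Num.truncn e^-1) => n Nn.
  rewrite -(rmorph_nat (real_complex R)) -fmorphV ltcR invf_plt ?posrE ?ltr0n//.
  rewrite (lt_le_trans (truncnS_gt _))// ler_nat ltnS//.
have ucau : forall e : R, 0 < e -> exists N, forall m n,
    (N <= m)%N -> (N <= n)%N -> Re (form (u m - u n) (u m - u n)) < e.
  move=> e e0; have se0 : 0 < Num.sqrt e by rewrite sqrtr_gt0.
  have [N hN] := inv_small _ (divr_gt0 se0 (ltr0Sn _ 1)).
  exists N => m n Nm Nn; rewrite -[e]sqr_sqrtr 1?ltW// small//.
  rewrite (lt_trans (uE _ _))// [X in X%:C]splitr rmorphD/= ltrD//; exact: hN.
have [l ul] := form_complete ucau.
apply/cvg_ex; exists l; apply/cvgrPdist_lt => e e0.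
have eE : e = (Re e)%:C by move: e0; case: (e) => a b; rewrite ltcE/= => /andP[/eqP->].
have re0 : 0 < Re e by rewrite -ltcR -eE.
have re2 : 0 < Re e / 2 by rewrite divr_gt0.
have re4 : 0 < (Re e / 2) ^+ 2 by rewrite exprn_gt0.
have [N1 h1] := ul _ re4; have [N2 h2] := inv_small _ re2.
pose n := maxn N1 N2.
apply: filterS (Fu n) => z; rewrite -ball_normE/= => zn.
rewrite -(subrK (u n) l) -addrA (le_lt_trans (ler_normD _ _))//.
rewrite eE [X in X%:C]splitr rmorphD/= ltrD//.
  by rewrite distrC -small// h1// leq_maxl.
by rewrite (lt_trans zn)// h2// leq_maxr.
Qed.

HB.instance Definition _ := Uniform_isComplete.Build H complete.
HB.instance Definition _ := NormedModule_isHilbert.Build R H formE.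
HB.end.

Section real_norm.
Variable R : realType.

(* The library norm of a normed module over R[i] takes its values in R[i]. *)
Definition rnorm (V : normedModType R[i]) (x : V) : R := Re `|x|.

Lemma normE (V : normedModType R[i]) (x : V) : `|x| = (rnorm x)%:C.
Proof.
by have := normr_ge0 x; rewrite /rnorm; case: `|x| => a b; rewrite lecE/= => /andP[/eqP->].
Qed.

Lemma rnorm_ge0 (V : normedModType R[i]) (x : V) : 0 <= rnorm x.
Proof. by have := normr_ge0 x; rewrite normE lecR. Qed.

Lemma ler_rnormD (V : normedModType R[i]) (x y : V) :
  rnorm (x + y) <= rnorm x + rnorm y.
Proof. by have := ler_normD x y; rewrite !normE -rmorphD lecR. Qed.

Lemma rnormN (V : normedModType R[i]) (x : V) : rnorm (- x) = rnorm x.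
Proof. by rewrite /rnorm normrN. Qed.

Lemma rnormZ (V : normedModType R[i]) a (x : V) :
  rnorm (a *: x) = Re `|a| * rnorm x.
Proof.
apply: complexI; rewrite -normE normrZ normE rmorphM/=; congr (_ * _).
Qed.

Lemma ReinnerE (V : hilbertType R) (x : V) : Re '[x, x] = rnorm x ^+ 2.
Proof. by rewrite innerE normE -rmorphXn. Qed.

Lemma innerrE (V : hilbertType R) (x : V) : '[x, x] = (rnorm x ^+ 2)%:C.
Proof. by rewrite innerE normE -rmorphXn. Qed.

Lemma ler_rnorm_inner (V : hilbertType R) (x y : V) :
  Re `|'[x, y]| <= rnorm x * rnorm y.
Proof.
have nE (z : R[i]) : `|z| = (Re `|z|)%:C by rewrite [in RHS]normc_def/= -normc_def.
have n0 : 0 <= Re `|'[x, y]| by rewrite -ler0c -nE.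
rewrite -(ler_pXn2r (n:=2)) ?nnegrE ?mulr_ge0 ?rnorm_ge0//.
have nE2 (z : R[i]) : (Re `|z| ^+ 2)%:C = `|z| ^+ 2 by rewrite [in RHS]nE -rmorphXn.
rewrite exprMn -lecR nE2 [leRHS]rmorphM/= -!innerrE.
exact: dot_CauchySchwarz.
Qed.

Lemma ler_rnormD2 (V : normedModType R[i]) (x y : V) :
  rnorm (x + y) ^+ 2 <= 2 * (rnorm x ^+ 2 + rnorm y ^+ 2).
Proof.
apply: (@le_trans _ _ ((rnorm x + rnorm y) ^+ 2)).
  by rewrite ler_pXn2r ?nnegrE ?addr_ge0 ?rnorm_ge0 ?ler_rnormD.
rewrite -subr_ge0; have -> : forall a b : R,
  2 * (a ^+ 2 + b ^+ 2) - (a + b) ^+ 2 = (a - b) ^+ 2 by move=> a b; ring.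
exact: sqr_ge0.
Qed.

Lemma hilbert_complete (V : hilbertType R) (u : nat -> V) :
  (forall e : R, 0 < e -> exists N, forall m n, (N <= m)%N -> (N <= n)%N ->
      Re '[u m - u n, u m - u n] < e) ->
  exists l, forall e : R, 0 < e -> exists N, forall n, (N <= n)%N ->
    Re '[u n - l, u n - l] < e.
Proof.
move=> uc.
have re (e : R[i]) : 0 < e -> 0 < Re e /\ e = (Re e)%:C.
  by case: e => a b; rewrite ltcE/= => /andP[/eqP-> a0].
have sm (x : V) (e : R[i]) : 0 < e -> (Re '[x, x] < Re e ^+ 2) = (`|x| < e).
  move=> /re[e0 eE]; rewrite [in RHS]eE normE ltcR ReinnerE ltr_pXn2r//.
    by rewrite nnegrE rnorm_ge0.
  by rewrite nnegrE ltW.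
have /cauchy_cvgP : cauchy (u @ \oo).
  apply/cauchyP => e e0; have [re0 _] := re _ e0.
  have [N hN] := uc _ (exprn_gt0 2 re0).
  exists (u N); exists N => // n /= Nn; rewrite -ball_normE/= -sm//.
  exact: hN.
move=> /cvg_ex[l ul]; exists l => e e0.
have se0 : 0 < (Num.sqrt e)%:C by rewrite ltcR sqrtr_gt0.
move/cvgrPdist_lt : ul => /(_ _ se0)[N _ hN]; exists N => n Nn.
by have := hN _ Nn; rewrite distrC -sm//= sqr_sqrtr// ltW.
Qed.

Lemma closure_normP (V : normedModType R[i]) (A : set V) x :
  closure A x <-> forall e : R, 0 < e -> exists2 y, A y & rnorm (x - y) < e.
Proof.
split=> [Ax e e0|Ax B].
  have e0' : 0 < e%:C by rewrite ltcR.
  have [y [Ay]] := Ax _ (nbhsx_ballx x _ e0').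
  by rewrite -ball_normE/= normE ltcR => yx; exists y.
move=> /nbhs_ballP[e /= e0 eB]; move: e0 eB; case: e => a b.
rewrite ltcE/= => /andP[/eqP-> /Ax[y Ay xy]] eB; exists y; split=> //.
by apply: eB; rewrite -ball_normE/= normE ltcR.
Qed.

End real_norm.

#[short(type="boundedOp")]
HB.structure Definition BoundedOp (R : realType) (V W : normedModType R[i]) :=
  {f of @GRing.Linear R[i] V W *:%R f & @Continuous V W f}.

Notation "{ 'bounded' V -> W }" := (boundedOp V%type W%type)
  (at level 0, V at level 98, W at level 99,
   format "{ 'bounded'  V  ->  W }") : type_scope.

Section closed_range.
Variables (R : realType) (V : normedModType R[i]) (W : hilbertType R).
Variable A : {bounded V -> W}.

Definition in_closed_range : {pred W} := mem (closure (range A)).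

Lemma in_closed_rangeP x :
  reflect (forall e : R, 0 < e -> exists v, rnorm (x - A v) < e)
          (x \in in_closed_range).
Proof.
apply: (iffP idP) => [|h].
  rewrite [_ \in _]/(x \in closure _) inE => /closure_normP h e /h[_ [v _ <-]].
  by exists v.
rewrite [_ \in _]/(x \in closure _) inE; apply/closure_normP => e /h[v xv].
by exists (A v) => //; exists v.
Qed.

Lemma closed_range_submod : submod_closed in_closed_range.
Proof.
split=> [|a x y /in_closed_rangeP xA /in_closed_rangeP yA].
  apply/in_closed_rangeP => e e0; exists 0.
  by rewrite linear0 subrr /rnorm normr0.
apply/in_closed_rangeP => e e0.
have c0 : 0 < Re `|a| + 1.
  by rewrite ltr_wpDl// -ler0c -(normE (a : R[i]^o)).
have [v xv] := xA _ (divr_gt0 (divr_gt0 e0 (ltr0Sn _ 1)) c0).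
have [w yw] := yA _ (divr_gt0 e0 (ltr0Sn _ 1)).
exists (a *: v + w); rewrite linearP opprD addrACA -scalerBr.
rewrite (le_lt_trans (ler_rnormD _ _))// [ltRHS]splitr ltr_leD ?(ltW yw)//.
rewrite rnormZ; move: xv; rewrite ltr_pdivlMr//; apply: le_lt_trans.
by rewrite mulrC ler_wpM2l ?rnorm_ge0// lerDl.
Qed.

HB.instance Definition _ :=
  GRing.isSubmodClosed.Build _ _ in_closed_range closed_range_submod.

Record closed_range : Type := ClosedRange {
  closed_range_val : W;
  closed_range_valP : closed_range_val \in in_closed_range }.

HB.instance Definition _ := [isSub for closed_range_val].
HB.instance Definition _ := [Choice of closed_range by <:].
HB.instance Definition _ := [SubChoice_isSubLmodule of closed_range by <:].

Let form (x y : closed_range) : R[i] := '[val x, val y].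

Let form_linear z : linear_for *%R (form^~ z).
Proof. by move=> a x y; rewrite /form linearP/= linearPl. Qed.

Let form_conj x y : form x y = ((form y x)^*)%R.
Proof. by rewrite /form hermC mul1r. Qed.

Let form_gt0 x : x != 0 -> 0 < form x x.
Proof. by move=> x0; rewrite /form dnorm_gt0. Qed.

Let form_complete (u : nat -> closed_range) :
  (forall e : R, 0 < e -> exists N, forall m n, (N <= m)%N -> (N <= n)%N ->
    Re (form (u m - u n) (u m - u n)) < e) ->
  exists l, forall e : R, 0 < e -> exists N, forall n, (N <= n)%N ->
    Re (form (u n - l) (u n - l)) < e.
Proof.
move=> uc; have [e e0|l ul] := @hilbert_complete R W (val \o u).
  have [N hN] := uc _ e0; exists N => m n Nm Nn.
  by have := hN _ _ Nm Nn; rewrite /form raddfB.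
have lA : l \in in_closed_range.
  apply/in_closed_rangeP => e e0; have e2 := divr_gt0 e0 (ltr0Sn R 1).
  have [N hN] := ul _ (exprn_gt0 2 e2); have {hN} := hN N (leqnn N).
  rewrite ReinnerE ltr_pXn2r ?nnegrE ?rnorm_ge0 ?(ltW e2)//= => uN.
  have /in_closed_rangeP/(_ _ e2)[v uv] := closed_range_valP (u N).
  exists v; rewrite -(subrK (val (u N)) l) -addrA.
  rewrite (le_lt_trans (ler_rnormD _ _))// [ltRHS]splitr ltrD//.
  by rewrite -rnormN opprB.
exists (ClosedRange lA) => e /ul[N hN]; exists N => n Nn.
by have := hN _ Nn; rewrite /form raddfB.
Qed.

HB.instance Definition _ := Lmodule_isHilbert.Build R closed_range
  form_linear form_conj form_gt0 form_complete.

Lemma closed_range_innerE (x y : closed_range) : '[x, y] = '[val x, val y].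
Proof. by []. Qed.

Lemma range_in_closed_range v : A v \in in_closed_range.
Proof.
by apply/in_closed_rangeP => e e0; exists v; rewrite subrr /rnorm normr0.
Qed.

Definition to_closed_range v : closed_range := ClosedRange (range_in_closed_range v).

End closed_range.

(* The orthogonal sum; an alias, since V * W already carries the sup norm. *)
Definition hsum (R : realType) (V W : hilbertType R) : Type := (V * W)%type.

Section hsum.
Variables (R : realType) (V W : hilbertType R).

HB.instance Definition _ := GRing.Lmodule.copy (hsum V W) (V * W)%type.

Let form (x y : hsum V W) : R[i] := '[x.1, y.1] + '[x.2, y.2].

Let form_linear z : linear_for *%R (form^~ z).
Proof. by move=> a x y; rewrite /form/= !linearPl mulrDr addrACA. Qed.

Let form_conj x y : form x y = ((form y x)^*)%R.
Proof. by rewrite /form !(hermC _ x.1) !(hermC _ x.2) !mul1r rmorphD. Qed.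

Let form_gt0 x : x != 0 -> 0 < form x x.
Proof.
case: x => x y; rewrite xpair_eqE negb_and /form/= => /orP[x0|y0].
  by rewrite ltr_wpDr ?dnorm_ge0// dnorm_gt0.
by rewrite ltr_wpDl ?dnorm_ge0// dnorm_gt0.
Qed.

Let form_complete (u : nat -> hsum V W) :
  (forall e : R, 0 < e -> exists N, forall m n, (N <= m)%N -> (N <= n)%N ->
    Re (form (u m - u n) (u m - u n)) < e) ->
  exists l, forall e : R, 0 < e -> exists N, forall n, (N <= n)%N ->
    Re (form (u n - l) (u n - l)) < e.
Proof.
have fE x : Re (form x x) = rnorm x.1 ^+ 2 + rnorm x.2 ^+ 2.
  by rewrite -!ReinnerE /form raddfD.
move=> uc.
have [e e0|l ul] := @hilbert_complete R V (fun n => (u n).1).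
  have [N hN] := uc _ e0; exists N => m n Nm Nn.
  apply: le_lt_trans (hN _ _ Nm Nn).
  by rewrite fE ReinnerE lerDl exprn_ge0 ?rnorm_ge0.
have [e e0|k uk] := @hilbert_complete R W (fun n => (u n).2).
  have [N hN] := uc _ e0; exists N => m n Nm Nn.
  apply: le_lt_trans (hN _ _ Nm Nn).
  by rewrite fE ReinnerE lerDr exprn_ge0 ?rnorm_ge0.
exists (l, k) => e e0; have e2 := divr_gt0 e0 (ltr0Sn R 1).
have [N1 h1] := ul _ e2; have [N2 h2] := uk _ e2; exists (maxn N1 N2) => n.
rewrite geq_max => /andP[/h1 ? /h2 ?].
by rewrite fE [ltRHS]splitr -!ReinnerE ltrD.
Qed.

HB.instance Definition _ := Lmodule_isHilbert.Build R (hsum V W)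
  form_linear form_conj form_gt0 form_complete.

Lemma hsum_innerE (x y : hsum V W) : '[x, y] = '[x.1, y.1] + '[x.2, y.2].
Proof. by []. Qed.

End hsum.

Section l2.
Variables (R : realType) (V : hilbertType R).

Definition square_summable : {pred nat -> V} :=
  [pred a | `[< cvgn (series (fun k => rnorm (a k) ^+ 2)) >]].

Lemma square_summableP (a : nat -> V) :
  reflect (exists M, forall n, \sum_(0 <= k < n) rnorm (a k) ^+ 2 <= M)
          (a \in square_summable).
Proof.
have nd : nondecreasing_seq (series (fun k => rnorm (a k) ^+ 2)).
  by apply: nondecreasing_series => n _ _; rewrite exprn_ge0 ?rnorm_ge0.
apply: (iffP (asboolP _)) => [ca|[M aM]].
  exists (limn (series (fun k => rnorm (a k) ^+ 2))) => n.
  exact: nondecreasing_cvgn_le.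
by apply: nondecreasing_is_cvgn => //; exists M => _ [n _ <-]; exact: aM.
Qed.

Lemma square_summable_submod : submod_closed square_summable.
Proof.
split=> [|c a b /square_summableP[M aM] /square_summableP[N bN]].
  apply/square_summableP; exists 0 => n; rewrite big1// => k _.
  by rewrite /rnorm normr0 expr0n.
apply/square_summableP; exists (2 * (Re `|c| ^+ 2 * M + N)) => n.
apply: (@le_trans _ _ (\sum_(0 <= k < n)
    2 * (Re `|c| ^+ 2 * rnorm (a k) ^+ 2 + rnorm (b k) ^+ 2))).
  by apply: ler_sum => k _; rewrite -exprMn -rnormZ; exact: ler_rnormD2.
by rewrite -mulr_sumr big_split/= -mulr_sumr ler_pM2l// lerD// ler_wpM2l ?exprn_even_ge0.
Qed.

HB.instance Definition _ :=
  GRing.isSubmodClosed.Build _ _ square_summable square_summable_submod.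

Record l2 : Type := L2 {
  l2_val :> nat -> V;
  l2_valP : l2_val \in square_summable }.

HB.instance Definition _ := [isSub for l2_val].
HB.instance Definition _ := [Choice of l2 by <:].
HB.instance Definition _ := [SubChoice_isSubLmodule of l2 by <:].

(* The sum of the series of the u k, taken on real and imaginary parts. *)
Definition csum (u : nat -> R[i]) : R[i] :=
  limn (series (fun k => Re (u k))) +i* limn (series (fun k => Im (u k))).

Let ccvg (u : nat -> R[i]) :=
  cvgn (series (fun k => Re (u k))) /\ cvgn (series (fun k => Im (u k))).

Let csum_linear a u v : ccvg u -> ccvg v ->
  csum (fun k => a * u k + v k) = a * csum u + csum v.
Proof.
case: a => c d [cu1 cu2] [cv1 cv2].
have rE : (fun k => Re ((c +i* d) * u k + v k)) =
    c *: (fun k => Re (u k)) - d *: (fun k => Im (u k)) + (fun k => Re (v k)).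
  by apply/funext => k; rewrite !fctE; case: (u k) (v k) => ? ? [].
have iE : (fun k => Im ((c +i* d) * u k + v k)) =
    c *: (fun k => Im (u k)) + d *: (fun k => Re (u k)) + (fun k => Im (v k)).
  by apply/funext => k; rewrite !fctE; case: (u k) (v k) => ? ? [].
rewrite /csum rE iE.
have cZ (r : R) (f : R^nat) : cvgn (series f) -> cvgn (series (r *: f)).
  exact: is_cvg_seriesZ.
rewrite (lim_seriesD (is_cvg_seriesB (cZ c _ cu1) (cZ d _ cu2)) cv1).
rewrite (lim_seriesD (is_cvg_seriesD (cZ c _ cu2) (cZ d _ cu1)) cv2).
rewrite (lim_seriesB (cZ c _ cu1) (cZ d _ cu2)) (lim_seriesD (cZ c _ cu2) (cZ d _ cu1)).
by rewrite !lim_seriesZ.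
Qed.

Let csum_conj u : ccvg u -> csum (fun k => ((u k)^*)%R) = ((csum u)^*)%R.
Proof.
move=> [cu1 cu2]; rewrite /csum.
have -> : (fun k => Re (u k)^*%R) = (fun k => Re (u k)).
  by apply/funext => k; case: (u k).
have -> : (fun k => Im (u k)^*%R) = - (fun k => Im (u k)).
  by apply/funext => k; rewrite !fctE; case: (u k).
by rewrite lim_seriesN.
Qed.

Let form (a b : l2) : R[i] := csum (fun k => '[a k, b k]).

Let form_cvg (a b : l2) : ccvg (fun k => '[a k, b k]).
Proof.
have [/square_summableP[M aM] /square_summableP[N bN]] := (l2_valP a, l2_valP b).
have ub (f : R[i] -> R) : (forall z, `|f z| <= Re `|z|) ->
    cvgn (series (fun k => f '[a k, b k])).
  move=> fz; apply: normed_cvg => /=.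
  apply: (@nondecreasing_is_cvgn R).
    by apply: nondecreasing_series => k _ _; exact: normr_ge0.
  exists (M + N) => _ [n _ <-]; rewrite /series/=.
  apply: le_trans (lerD (aM n) (bN n)); rewrite -big_split/=.
  apply: ler_sum => k _; apply: le_trans (fz _) _.
  apply: le_trans (ler_rnorm_inner _ _) _.
  have := rnorm_ge0 (a k); have := rnorm_ge0 (b k).
  move: (rnorm _) (rnorm _) => x y; nra.
by split; apply: ub => -[x y] /=; rewrite -sqrtr_sqr ler_wsqrtr// ?lerDl ?lerDr sqr_ge0.
Qed.

Let form_linear z : linear_for *%R (form^~ z).
Proof.
move=> a x y; rewrite /form -csum_linear; [|exact: form_cvg..].
by congr csum; apply/funext => k; rewrite linearPl.
Qed.

Let form_conj x y : form x y = ((form y x)^*)%R.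
Proof.
rewrite /form -csum_conj; last exact: form_cvg.
by congr csum; apply/funext => k; rewrite hermC mul1r.
Qed.

Let formE (x : l2) : form x x = (limn (series (fun k => rnorm (x k) ^+ 2)))%:C.
Proof.
rewrite /form /csum; under eq_fun do rewrite ReinnerE.
under [in X in _ +i* X]eq_fun do rewrite innerrE/=.
rewrite (_ : series (fun=> 0) = cst 0) ?lim_cst//.
by apply/funext => n; rewrite /series/= big1.
Qed.

Let form_part (x : l2) n : \sum_(0 <= k < n) rnorm (x k) ^+ 2 <= Re (form x x).
Proof.
rewrite formE/=; apply: nondecreasing_cvgn_le.
  by apply: nondecreasing_series => k _ _; rewrite exprn_ge0 ?rnorm_ge0.
exact/asboolP/(l2_valP x).
Qed.

Let form_term (x : l2) n : rnorm (x n) ^+ 2 <= Re (form x x).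
Proof.
apply: le_trans (form_part x n.+1); rewrite big_nat_recr//= lerDr.
by rewrite sumr_ge0// => k _; rewrite exprn_ge0 ?rnorm_ge0.
Qed.

Let form_gt0 x : x != 0 -> 0 < form x x.
Proof.
move=> x0; rewrite formE ltcR -[ltRHS]/(Re (_)%:C) -formE.
have [n xn] : exists n, x n != 0.
  apply: contrapT => /forallNP h; move/eqP: x0; apply; apply/val_inj/funext => n /=.
  by apply/eqP; have := h n; case: eqP.
apply: lt_le_trans (form_term x n); rewrite exprn_gt0//.
by rewrite -ltcR -normE normr_gt0.
Qed.

Let form_le (x : l2) e : (forall n, \sum_(0 <= k < n) rnorm (x k) ^+ 2 <= e) ->
  Re (form x x) <= e.
Proof.
move=> xe; rewrite formE/=; apply: limr_le; first exact/asboolP/(l2_valP x).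
by near=> n; exact: xe.
Unshelve. all: by end_near. Qed.

Let form_complete (u : nat -> l2) :
  (forall e : R, 0 < e -> exists N, forall m n, (N <= m)%N -> (N <= n)%N ->
    Re (form (u m - u n) (u m - u n)) < e) ->
  exists l, forall e : R, 0 < e -> exists N, forall n, (N <= n)%N ->
    Re (form (u n - l) (u n - l)) < e.
Proof.
move=> uc.
have /choice[l ul] k : exists l, forall e : R, 0 < e ->
    exists N, forall n, (N <= n)%N -> Re '[u n k - l, u n k - l] < e.
  apply: (@hilbert_complete R V (fun n => u n k)) => e e0.
  have [N hN] := uc _ e0; exists N => m n Nm Nn.
  by apply: le_lt_trans (hN _ _ Nm Nn); rewrite ReinnerE; exact: (form_term (u m - u n) k).
have lim_part (x : nat -> V) e N n :
    (forall m, (N <= m)%N -> \sum_(0 <= k < n) rnorm (x k - u m k) ^+ 2 <= e) ->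
    \sum_(0 <= k < n) rnorm (x k - l k) ^+ 2 <= e.
  move=> xe.
  have cvg_term k : (fun m => rnorm (x k - u m k) ^+ 2) @ \oo --> rnorm (x k - l k) ^+ 2.
    suff h : (fun m => rnorm (x k - u m k)) @ \oo --> rnorm (x k - l k).
      exact: (cvgM h h).
    apply/cvgrPdist_lt => d d0.
    have [M hM] := ul k _ (exprn_gt0 2 d0); exists M => // m /= Mm.
    have := hM _ Mm; rewrite ReinnerE ltr_pXn2r ?nnegrE ?rnorm_ge0 ?(ltW d0)//.
    apply: le_lt_trans.
    have h1 := ler_rnormD (x k - u m k) (u m k - l k).
    have h2 := ler_rnormD (x k - l k) (- (u m k - l k)).
    rewrite rnormN in h2; rewrite addrA subrK in h1.
    rewrite opprB addrA subrK in h2.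
    by rewrite ler_norml; apply/andP; split; lra.
  have : (fun m => \sum_(0 <= k < n) rnorm (x k - u m k) ^+ 2) @ \oo -->
      \sum_(0 <= k < n) rnorm (x k - l k) ^+ 2.
    elim: n {xe} => [|n IHn].
      by rewrite big_nil; under eq_fun do rewrite big_nil; exact: cvg_cst.
    rewrite big_nat_recr//=; under eq_fun do rewrite big_nat_recr//=.
    exact: cvgD.
  by move/cvgr_to_le; apply; exists N => // m; exact: xe.
have tail (e : R) : 0 < e -> exists N, forall m, (N <= m)%N ->
    forall n, \sum_(0 <= k < n) rnorm (u m k - l k) ^+ 2 <= e.
  move=> /uc[N hN]; exists N => m Nm n; apply: (lim_part _ _ N) => p Np.
  exact: le_trans (form_part (u m - u p) n) (ltW (hN _ _ Nm Np)).
have lV : l \in square_summable.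
  have [N hN] := tail 1 ltr01.
  have dN : (u N : nat -> V) - l \in square_summable.
    by apply/square_summableP; exists 1; exact: hN.
  by rewrite -[l](subKr (u N : nat -> V)) rpredB// l2_valP.
exists (L2 lV) => e e0; have [N hN] := tail _ (divr_gt0 e0 (ltr0Sn R 1)).
exists N => n /hN h; have e2 : e / 2 < e by lra.
by apply: le_lt_trans e2; apply: form_le => m; exact: h.
Qed.

HB.instance Definition _ := Lmodule_isHilbert.Build R l2
  form_linear form_conj form_gt0 form_complete.

Lemma l2_innerE (a b : l2) : '[a, b] = csum (fun k => '[a k, b k]).
Proof. by []. Qed.

End l2.

Section operators.
Variable R : realType.
Implicit Types V W : hilbertType R.

(* Riesz: for bounded A the vector z below exists and is unique. *)
Definition adj V W (A : V -> W) (y : W) : V :=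
  xget 0 [set z | forall x, '[A x, y] = '[x, z]].

Definition orth_proj V (M : set V) (y : V) : V :=
  xget 0 [set x | M x /\ forall z, M z -> '[y - x, z] = 0].

Definition opnorm V W (A : V -> W) : R :=
  sup [set rnorm (A x) | x in [set x | rnorm x <= 1]].

Definition unitary_op V W (A : V -> W) :=
  (forall x, adj A (A x) = x) /\ (forall y, A (adj A y) = y).

Definition normal_op V (A : V -> V) := forall x, A (adj A x) = adj A (A x).

Definition commuting_ops V (A B : V -> V) := forall x, A (B x) = B (A x).

Section bounded_zero.
Variables V W : hilbertType R.

Let zero_linear : linear (cst 0 : V -> W).
Proof. by move=> a x y; rewrite scaler0 addr0. Qed.

Let zero_continuous : continuous (cst 0 : V -> W).
Proof. exact: cst_continuous. Qed.

Definition bounded_zero : {bounded V -> W} :=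
  HB.pack (cst 0 : V -> W) (GRing.isLinear.Build _ _ _ _ _ zero_linear)
    (isContinuous.Build _ _ _ zero_continuous).

HB.instance Definition _ := gen_eqMixin {bounded V -> W}.
HB.instance Definition _ := gen_choiceMixin {bounded V -> W}.
End bounded_zero.

(* The positive square root of a positive bounded operator, which exists and
   is unique.  Over the complex field 0 <= '[D x, x] (in R[i]: a nonnegative
   real) forces D to be self-adjoint. *)
Definition sqrt_op V (T : V -> V) : {bounded V -> V} :=
  xget (bounded_zero V V)
    [set D : {bounded V -> V} |
      (forall x, 0 <= '[D x, x]) /\ (forall x, D (D x) = T x)].

(* Exactness of the Koszul complex 0 -> V -> V (+) V -> V -> 0 of a commuting
   pair, with differentials z |-> (A z, B z) and (x, y) |-> A y - B x. *)
Definition koszul_exact V (A B : V -> V) :=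
  [/\ forall z, A z = 0 -> B z = 0 -> z = 0,
      forall x y, A y - B x = 0 -> exists z, x = A z /\ y = B z
    & forall z, exists x y, z = A y - B x].

(* The Taylor joint spectrum. *)
Definition joint_spectrum V (A B : V -> V) : set (R[i] * R[i]) :=
  [set l | ~ koszul_exact (fun x => A x - l.1 *: x) (fun x => B x - l.2 *: x)].

Definition int_power V (U : V -> V) (n : int) (x : V) : V :=
  match n with Posz k => iter k U x | Negz k => iter k.+1 (adj U) x end.

Definition subspace_set V (M : set V) :=
  M 0 /\ forall (a : R[i]) x y, M x -> M y -> M (a *: x + y).

Definition closed_span V (A : set V) : set V :=
  closure (smallest (@subspace_set V) A).

End operators.

Section symmetrized_bidisc.
Variable R : realType.
Implicit Types H K : hilbertType R.

Definition Gamma : set (R[i] * R[i]) :=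
  [set (z.1 + z.2, z.1 * z.2) | z in [set z : R[i] * R[i] |
    `|z.1| <= 1 /\ `|z.2| <= 1]].

Definition bGamma : set (R[i] * R[i]) :=
  [set (z.1 + z.2, z.1 * z.2) | z in [set z : R[i] * R[i] |
    `|z.1| = 1 /\ `|z.2| = 1]].

(* f is seen as a polynomial in s whose coefficients are polynomials in p;
   f.[s, p] is its value at (s, p). *)
Definition poly2_op H (f : {poly {poly R[i]}}) (S P : H -> H) (x : H) : H :=
  \sum_(i < size f) \sum_(j < size f`_i) f`_i`_j *: iter i S (iter j P x).

Definition gamma_contraction H (S P : {bounded H -> H}) :=
  commuting_ops S P /\
  forall f : {poly {poly R[i]}},
    opnorm (poly2_op f S P) <= sup [set Re `|f.[sp.1, sp.2]| | sp in Gamma].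

Definition gamma_unitary K (T U : {bounded K -> K}) :=
  [/\ commuting_ops T U, normal_op T, normal_op U
    & joint_spectrum T U `<=` bGamma].

(* In the next three definitions J : H -> K is the isometry through which H
   is regarded as a subspace of K. *)
Definition gamma_unitary_dilation H K (J : H -> K) (S P : {bounded H -> H})
    (T U : {bounded K -> K}) :=
  gamma_unitary T U /\
  forall m n h, J (iter m S (iter n P h)) =
    orth_proj (range J) (iter m T (iter n U (J h))).

Definition unitary_dilation H K (J : H -> K) (P : {bounded H -> H})
    (U : {bounded K -> K}) :=
  unitary_op U /\
  forall n h, J (iter n P h) = orth_proj (range J) (iter n U (J h)).

Definition minimal_unitary_dilation H K (J : H -> K) (P : {bounded H -> H})
    (U : {bounded K -> K}) :=
  unitary_dilation J P U /\
  closed_span [set x | exists n h, x = int_power U n (J h)] = [set: K].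

Definition unitarily_equivalent K1 K2 (T1 U1 : {bounded K1 -> K1})
    (T2 U2 : {bounded K2 -> K2}) :=
  exists W : {bounded K1 -> K2}, unitary_op W /\
    forall x, W (T1 (adj W x)) = T2 x /\ W (U1 (adj W x)) = U2 x.

End symmetrized_bidisc.

Section dilation_space.
Variables (R : realType) (H : hilbertType R).

Definition defect (P : {bounded H -> H}) : {bounded H -> H} :=
  sqrt_op (fun h => h - adj P (P h)).

Definition codefect (P : {bounded H -> H}) : {bounded H -> H} :=
  sqrt_op (fun h => h - P (adj P h)).

Definition defect_space (P : {bounded H -> H}) : hilbertType R :=
  closed_range (defect P).

Definition codefect_space (P : {bounded H -> H}) : hilbertType R :=
  closed_range (codefect P).

Variable P : {bounded H -> H}.

Definition fundamental_op (S : {bounded H -> H})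
    (F : {bounded defect_space P -> defect_space P}) :=
  forall h, S h - adj S (P h) =
    defect P (val (F (to_closed_range (defect P) h))).

(* The fundamental operator of the pair formed by the adjoints of S and P. *)
Definition cofundamental_op (S : {bounded H -> H})
    (G : {bounded codefect_space P -> codefect_space P}) :=
  forall h, adj S h - S (adj P h) =
    codefect P (val (G (to_closed_range (codefect P) h))).

Definition dilation_space : hilbertType R :=
  hsum H (hsum (l2 (defect_space P)) (l2 (codefect_space P))).

Definition embed (h : H) : dilation_space := (h, (0, 0)).

Definition is_dilation_U (U : {bounded dilation_space -> dilation_space}) :=
  forall (h : H) (a : l2 (defect_space P)) (b : l2 (codefect_space P)),
  let x := U (h, (a, b)) in
  [/\ x.1 = P h + codefect P (val (b 0%N)),
      val (x.2.1 0%N) = defect P h - adj P (val (b 0%N)),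
      forall n, x.2.1 n.+1 = a n
    & forall n, x.2.2 n = b n.+1].

Definition is_dilation_R (S : {bounded H -> H})
    (F : {bounded defect_space P -> defect_space P})
    (G : {bounded codefect_space P -> codefect_space P})
    (T : {bounded dilation_space -> dilation_space}) :=
  forall (h : H) (a : l2 (defect_space P)) (b : l2 (codefect_space P)),
  let x := T (h, (a, b)) in
  [/\ x.1 = S h + codefect P (val (G (b 0%N))),
      val (x.2.1 0%N) = val (adj F (to_closed_range (defect P) h))
        + val (F (a 0%N)) - adj P (val (G (b 0%N))),
      forall n, x.2.1 n.+1 = adj F (a n) + F (a n.+1)
    & forall n, x.2.2 n = adj G (b n) + G (b n.+1)].

End dilation_space.

(* Main.v *)
Require Import Defs.
From HB Require Import structures.
From mathcomp Require Import all_boot all_order all_algebra.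
From mathcomp Require Import complex sesquilinear ring lra.
From mathcomp Require Import boolp classical_sets reals topology normedtype sequences.
Set Implicit Arguments. Unset Strict Implicit. Unset Printing Implicit Defensive.
Import Order.TTheory GRing.Theory Num.Theory.
Import numFieldNormedType.Exports.
Local Open Scope ring_scope.

(** Why the dilation is unique.  Let [(T, U)] be a Gamma-unitary on a space [K]
    that contains [H] through an isometry [J], with [S ^ m P ^ n] the compression of
    [T ^ m U ^ n].  The operator [U] is unitary and [T = T^* U] (below), while [T]
    commutes with [U] and [U^*].  Hence
      [<T U ^ n J h, U ^ m J k>]
    depends on [n - m] only.  If [n >= m] it is [<P ^ (n - m) S h, k>] by the
    dilation property; if [n < m], moving [T = T^* U] to the other side turns it into
    [<h, S P ^ (m - n - 1) k>].  So the matrix of [T] in the family [U ^ n J h]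
    depends on [(S, P)] alone ([orbit_twisted_moment]), and so does the Gram matrix of
    this family ([orbit_moment]).  When the family is total, [T] is determined by [U]
    ([model_unique]), and two dilations with total families are unitarily equivalent
    ([model_equivalence]).

    It remains to see that the explicit pair has these matrices too; the
    record [dilation_model] collects the properties that the argument above uses.
    Its [U] is unitary ([dilation_U_unitary]) and minimal ([dilation_U_minimal]),
    its [T] commutes with [U] because of four algebraic identities relating [F],
    [G], [S] and [P] ([dilation_commute]), and the entries of the matrix are read
    off from [T J h] ([schaeffer_model]). All this needs the defect operators to be
    genuine positive square roots with [P D = Dc P] ([sqrt_opP], [sqrt_op_morph]):
    they are limits of polynomials in [P^* P] and [P P^*].

    The relation [T = T^* U] ([gamma_unitary_adj]) comes from the joint spectrum, since
    [s = conj s * p] on the distinguished boundary.  In place of the spectral theorem,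
    self-adjoint operators are localized by cutting hyperinvariant subspaces with the
    sign of [A - t] ([hyperinvariant_cut], [localize]).  Nested cuts produce a joint
    approximate eigenvalue of [(T, U)] on a subspace where [T - T^* U] is bounded below
    ([joint_approximate_eigenvalue]), and a gliding hump shows that such a point makes
    the Koszul complex inexact ([joint_spectrum_approx]). *)

Local Notation Re := complex.Re.
Local Notation Im := complex.Im.
Local Notation "x %:C" := (real_complex _ x) : ring_scope.

(** * Complex moduli and inner products *)

Section complex_modulus.
Variable R : realType.
Implicit Types a b : R[i].

(** The modulus as a real number, so that real arithmetic applies to it. *)
Definition cmod a : R := Re `|a|.

Lemma cmodE a : `|a| = (cmod a)%:C.
Proof. by rewrite /cmod [in RHS]normc_def/= -normc_def. Qed.

Lemma cmod_ge0 a : 0 <= cmod a.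
Proof. by rewrite -ler0c -cmodE normr_ge0. Qed.

Lemma cmodD a b : cmod (a + b) <= cmod a + cmod b.
Proof. by rewrite -lecR rmorphD /= -!cmodE ler_normD. Qed.

Lemma cmodN a : cmod (- a) = cmod a.
Proof. by rewrite /cmod normrN. Qed.

Lemma cmod_real (r : R) : cmod r%:C = `|r|.
Proof. by rewrite /cmod normc_def /= expr0n /= addr0 sqrtr_sqr. Qed.

Lemma cmod_sqr a : (cmod a ^+ 2)%:C = a * a^*.
Proof. by rewrite rmorphXn /= -cmodE normCK. Qed.

Lemma cmod_eq0 a : cmod a = 0 -> a = 0.
Proof. by move=> h; apply/eqP; rewrite -normr_eq0 cmodE h. Qed.

Lemma ler_Re_cmod a : Re a <= cmod a.
Proof. by apply: (le_trans (ler_norm _)); rewrite -lecR -cmodE normc_ge_Re. Qed.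

Lemma real_conj a : a^* = a -> a = (Re a)%:C.
Proof.
by case: a => x y [] /eqP; rewrite eq_sym -addr_eq0 -mulr2n mulrn_eq0 /= => /eqP ->.
Qed.

Lemma Re_addJ a : a + a^* = (2 * Re a)%:C.
Proof. by case: a => x y; apply/eqP; rewrite eq_complex /= subrr mulr2n mulrDl mul1r !eqxx. Qed.

Lemma conj_real (r : R) : (r%:C)^* = r%:C.
Proof. exact: conjc_real. Qed.

Lemma Re_conjC a : Re a^* = Re a.
Proof. by case: a. Qed.

End complex_modulus.

Section inner_theory.
Variables (R : realType) (V : hilbertType R).
Implicit Types (x y z : V) (a : R[i]).

Lemma innerDl x y z : '[x + y, z] = '[x, z] + '[y, z].
Proof. exact: linearDl. Qed.
Lemma innerBl x y z : '[x - y, z] = '[x, z] - '[y, z].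
Proof. exact: linearBl. Qed.
Lemma innerNl x z : '[- x, z] = - '[x, z].
Proof. exact: linearNl. Qed.
Lemma innerZl a x z : '[a *: x, z] = a * '[x, z].
Proof. exact: linearZl_LR. Qed.
Lemma inner0l z : '[0, z] = 0 :> R[i].
Proof. exact: linear0l. Qed.
Lemma innerDr x y z : '[z, x + y] = '[z, x] + '[z, y].
Proof. exact: linearDr. Qed.
Lemma innerBr x y z : '[z, x - y] = '[z, x] - '[z, y].
Proof. exact: linearBr. Qed.
Lemma innerNr x z : '[z, - x] = - '[z, x].
Proof. exact: linearNr. Qed.
Lemma innerZr a x z : '[z, a *: x] = a^* * '[z, x].
Proof. exact: linearZr_LR. Qed.
Lemma inner0r z : '[z, 0] = 0 :> R[i].
Proof. exact: linear0r. Qed.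

Definition inner_expand := (innerDl, innerBl, innerNl, innerZl, inner0l,
  innerDr, innerBr, innerNr, innerZr, inner0r).

Lemma innerC x y : '[x, y] = '[y, x]^*.
Proof. by rewrite hermC mul1r. Qed.

Lemma inner_eq0 x : '[x, x] = 0 -> x = 0.
Proof. by move/eqP; rewrite dnorm_eq0 => /eqP. Qed.

Lemma inner_ext x y : (forall z, '[x, z] = '[y, z]) -> x = y.
Proof.
by move=> h; apply/eqP; rewrite -subr_eq0; apply/eqP/inner_eq0; rewrite innerBl h subrr.
Qed.

Lemma inner_extr x y : (forall z, '[z, x] = '[z, y]) -> x = y.
Proof. by move=> h; apply: inner_ext => z; rewrite innerC h -innerC. Qed.

Lemma rnorm0 : rnorm (0 : V) = 0.
Proof. by rewrite /rnorm normr0. Qed.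

Lemma rnorm_eq0 x : rnorm x = 0 -> x = 0.
Proof. by move=> h; apply/eqP; rewrite -normr_eq0 normE h. Qed.

Lemma rnorm_gt0 x : x <> 0 -> 0 < rnorm x.
Proof. by move=> h; rewrite lt_def rnorm_ge0 andbT; apply/eqP => /rnorm_eq0. Qed.

Lemma rnormB x y : rnorm (x - y) = rnorm (y - x).
Proof. by rewrite -rnormN opprB. Qed.

Lemma ler_rnormB x y : rnorm (x - y) <= rnorm x + rnorm y.
Proof. by rewrite -(rnormN y) ler_rnormD. Qed.

Lemma ler_rnorm_dist x y z : rnorm (x - z) <= rnorm (x - y) + rnorm (y - z).
Proof. by apply: le_trans (ler_rnormD _ _); rewrite addrA subrK. Qed.

Lemma rnormZc a x : rnorm (a *: x) = cmod a * rnorm x.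
Proof. exact: rnormZ. Qed.

Lemma rnormZr (r : R) x : rnorm (r%:C *: x) = `|r| * rnorm x.
Proof. by rewrite rnormZc cmod_real. Qed.

Lemma ler_cmod_inner x y : cmod '[x, y] <= rnorm x * rnorm y.
Proof. exact: ler_rnorm_inner. Qed.

Lemma rnorm_sqrD x y :
  rnorm (x + y) ^+ 2 = rnorm x ^+ 2 + rnorm y ^+ 2 + 2 * Re '[x, y].
Proof.
apply: complexI; rewrite 2!rmorphD /= -!innerrE -Re_addJ -innerC !inner_expand.
ring.
Qed.

Lemma rnorm_sqrB x y :
  rnorm (x - y) ^+ 2 = rnorm x ^+ 2 + rnorm y ^+ 2 - 2 * Re '[x, y].
Proof. by rewrite rnorm_sqrD rnormN innerNr raddfN mulrN. Qed.

Lemma ler_sqr_rnorm x (c : R) : 0 <= c -> (rnorm x ^+ 2 <= c ^+ 2) = (rnorm x <= c).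
Proof. by move=> c0; rewrite ler_pXn2r// nnegrE ?rnorm_ge0. Qed.

Lemma rnorm_inner (W : hilbertType R) x (y : W) : '[x, x] = '[y, y] -> rnorm x = rnorm y.
Proof.
rewrite !innerrE => /complexI h; apply/eqP.
by rewrite -(eqrXn2 (n:=2)) ?rnorm_ge0 ?h.
Qed.

(** The best approximation of [w] by multiples of [z] is the orthogonal
    projection of [w], which is [0] only when [w] and [z] are orthogonal. *)
Lemma orthogonal_of_min w z :
  (forall a, rnorm w <= rnorm (w - a *: z)) -> '[w, z] = 0.
Proof.
move=> h; have [->|z0] := eqVneq z 0; first exact: inner0r.
have zz : '[z, z] != 0 by rewrite dnorm_eq0.
have zp : 0 < rnorm z by apply: rnorm_gt0 => /eqP; rewrite (negPf z0).
pose a := '[w, z] / '[z, z].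
have := h a; rewrite -ler_sqr_rnorm ?rnorm_ge0// rnorm_sqrB rnormZc exprMn.
have -> : Re '[w, a *: z] = cmod a ^+ 2 * rnorm z ^+ 2.
  rewrite innerZr (_ : '[w, z] = a * '[z, z]); last by rewrite divfK.
  by rewrite mulrA (mulrC _ a) -cmod_sqr innerrE -rmorphM.
move=> {}h; have /eqP : cmod a ^+ 2 * rnorm z ^+ 2 = 0.
  by apply/eqP; rewrite eq_le mulr_ge0 ?exprn_ge0 ?cmod_ge0 ?rnorm_ge0 // andbT; lra.
rewrite -exprMn sqrf_eq0 mulf_eq0 (gt_eqF zp) orbF => /eqP/cmod_eq0/eqP.
by rewrite mulf_eq0 invr_eq0 (negPf zz) orbF => /eqP.
Qed.

End inner_theory.

(** * Convergence, bounded operators and adjoints *)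

Section convergence.
Variable R : realType.

(** Norm convergence, in the form delivered by [hilbert_complete]. *)
Definition hlim (V : hilbertType R) (u : nat -> V) (l : V) :=
  forall e : R, 0 < e -> exists N, forall n, (N <= n)%N -> rnorm (u n - l) < e.

Lemma hlim_cauchy (V : hilbertType R) (u : nat -> V) :
  (forall e : R, 0 < e -> exists N, forall m n, (N <= m)%N -> (N <= n)%N ->
    rnorm (u m - u n) < e) -> exists l, hlim u l.
Proof.
move=> uc; have [e e0|l ul] := @hilbert_complete R V u.
  have se : 0 < Num.sqrt e by rewrite sqrtr_gt0.
  have [N hN] := uc _ se; exists N => m n Nm Nn.
  rewrite ReinnerE -[e]sqr_sqrtr 1?ltW// ltr_pXn2r ?nnegrE ?rnorm_ge0 ?sqrtr_ge0//.
  exact: hN.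
exists l => e e0; have [N hN] := ul _ (exprn_gt0 2 e0); exists N => n /hN.
by rewrite ReinnerE ltr_pXn2r ?nnegrE ?rnorm_ge0 ?(ltW e0).
Qed.

Lemma hlim_unique (V : hilbertType R) (u : nat -> V) l k :
  hlim u l -> hlim u k -> l = k.
Proof.
move=> ul uk; apply: contrapT => lk; have d0 : 0 < rnorm (l - k).
  by apply: rnorm_gt0 => /eqP; rewrite subr_eq0 => /eqP.
have [N hN] := ul _ (divr_gt0 d0 (ltr0Sn R 1)).
have [M hM] := uk _ (divr_gt0 d0 (ltr0Sn R 1)).
have h1 := hN _ (leq_maxl N M); have h2 := hM _ (leq_maxr N M).
have := ler_rnorm_dist l (u (maxn N M)) k; rewrite (rnormB l (u _)) => h3.
by clear lk; lra.
Qed.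

Lemma hlimD (V : hilbertType R) (u v : nat -> V) l k :
  hlim u l -> hlim v k -> hlim (fun n => u n + v n) (l + k).
Proof.
move=> ul vk e e0; have [N hN] := ul _ (divr_gt0 e0 (ltr0Sn R 1)).
have [M hM] := vk _ (divr_gt0 e0 (ltr0Sn R 1)); exists (maxn N M) => n.
rewrite geq_max => /andP[/hN h1 /hM h2]; rewrite opprD addrACA.
have := ler_rnormD (u n - l) (v n - k); lra.
Qed.

Lemma hlim_bound (V W : hilbertType R) (f : V -> W) (c : R) (u : nat -> V) l :
  (forall x y, rnorm (f x - f y) <= c * rnorm (x - y)) ->
  hlim u l -> hlim (f \o u) (f l).
Proof.
move=> fc ul e e0; have c0 : 0 < `|c| + 1 by rewrite ltr_wpDl.
have [N hN] := ul _ (divr_gt0 e0 c0); exists N => n /hN.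
rewrite ltr_pdivlMr// /= => h; apply: (le_lt_trans (fc _ _)); apply: le_lt_trans h.
rewrite mulrC ler_wpM2l ?rnorm_ge0// (le_trans (ler_norm _))// lerDl ler01//.
Qed.

Lemma hlim_le (V : hilbertType R) (u : nat -> V) l (x : V) (c : R) :
  hlim u l -> (exists N, forall n, (N <= n)%N -> rnorm (u n - x) <= c) ->
  rnorm (l - x) <= c.
Proof.
move=> ul [M hM]; apply/ler_addgt0Pr => e e0; have [N hN] := ul _ e0.
have h1 := hN _ (leq_maxl N M); have h2 := hM _ (leq_maxr N M).
have := ler_rnorm_dist l (u (maxn N M)) x; rewrite (rnormB l (u _)) => h3; lra.
Qed.

End convergence.

Section bounded_operators.
Variable R : realType.

Lemma bounded_bound (V W : normedModType R[i]) (A : {bounded V -> W}) :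
  exists2 c : R, 0 <= c & forall x, rnorm (A x) <= c * rnorm x.
Proof.
have /linear_boundedP : bounded_near A (nbhs (0 : V)).
  by apply: continuous_linear_bounded; exact: cts_fun.
move=> /pinfty_ex_gt0[r r0 h]; exists (Re r) => [|x].
  by move: r0; rewrite ltcE => /andP[_ /ltW].
have rE : r = (Re r)%:C by apply: real_conj; rewrite conj_Creal// gtr0_real.
by have := h x; rewrite rE !normE -rmorphM lecR.
Qed.

Lemma bounded_linearW (V W : normedModType R[i]) (A : {bounded V -> W}) : linear A.
Proof. exact: linearP. Qed.

Section bounded_linearity.
Variables (V W : normedModType R[i]) (A : {bounded V -> W}).

Lemma boundedP a x y : A (a *: x + y) = a *: A x + A y.
Proof. exact: linearP. Qed.
Lemma boundedD x y : A (x + y) = A x + A y.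
Proof. exact: linearD. Qed.
Lemma boundedB x y : A (x - y) = A x - A y.
Proof. exact: linearB. Qed.
Lemma boundedN x : A (- x) = - A x.
Proof. exact: linearN. Qed.
Lemma boundedZ a x : A (a *: x) = a *: A x.
Proof. exact: linearZ. Qed.
Lemma bounded0 : A 0 = 0.
Proof. exact: linear0. Qed.

End bounded_linearity.

Lemma bound_continuous (V W : normedModType R[i]) (f : {linear V -> W}) (c : R) :
  (forall x, rnorm (f x) <= c * rnorm x) -> continuous f.
Proof.
move=> fc; apply: bounded_linear_continuous; apply/linear_boundedP.
near=> r => x; rewrite !normE; apply: (@le_trans _ _ (c%:C * (rnorm x)%:C)).
  by rewrite -rmorphM lecR.
rewrite ler_wpM2r ?ler0c ?rnorm_ge0//; near: r; apply: nbhs_pinfty_ge.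
by apply/complex_realP; exists c.
Unshelve. all: by end_near. Qed.

Definition mk_linear (V W : normedModType R[i]) (f : V -> W) (lf : linear f) :
  {linear V -> W} := HB.pack f (GRing.isLinear.Build _ _ _ _ _ lf).

Definition mk_bounded (V W : normedModType R[i]) (f : V -> W) (lf : linear f)
    (bf : exists c : R, forall x, rnorm (f x) <= c * rnorm x) : {bounded V -> W} :=
  HB.pack f (GRing.isLinear.Build _ _ _ _ _ lf) (isContinuous.Build _ _ f
    (let: ex_intro c fc := bf in @bound_continuous V W (mk_linear lf) c fc)).

Lemma mk_boundedE (V W : normedModType R[i]) (f : V -> W) lf bf x :
  @mk_bounded V W f lf bf x = f x.
Proof. by []. Qed.

Lemma hlim_bounded (V W : hilbertType R) (A : {bounded V -> W}) (u : nat -> V) l :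
  hlim u l -> hlim (A \o u) (A l).
Proof.
have [c _ Ac] := bounded_bound A; apply: (@hlim_bound _ _ _ _ c) => x y.
by rewrite -linearB Ac.
Qed.

End bounded_operators.

(** * Orthogonal projection, the Riesz theorem and adjoints *)

Section projection.
Variables (R : realType) (V : hilbertType R).

(** A minimizing sequence for the distance from [x] to [M] is Cauchy by the
    parallelogram law; its limit is the foot of the perpendicular. *)
Lemma projection_theorem (M : set V) :
  subspace_set M ->
  (forall x, (forall e : R, 0 < e -> exists2 y, M y & rnorm (x - y) < e) -> M x) ->
  forall x, exists2 m, M m & forall z, M z -> '[x - m, z] = 0.
Proof.
move=> [M0 ML] Mcl x.
pose D := [set rnorm (x - y) | y in M]%classic.
have D0 : has_inf D.
  split; first by exists (rnorm (x - 0)); exists 0.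
  by exists 0 => _ [y _ <-]; exact: rnorm_ge0.
pose d := inf D.
have dle y : M y -> d <= rnorm (x - y) by move=> My; apply: ge_inf; [case: D0|exists y].
have d0 : 0 <= d by apply: lb_le_inf; [case: D0|move=> _ [y _ <-]; exact: rnorm_ge0].
pose iv (n : nat) : R := n.+1%:R^-1.
have [u uM] : exists u : nat -> V, forall n, M (u n) /\ rnorm (x - u n) < d + iv n.
  suff /choice[v hv] : forall n : nat, exists y, M y /\ rnorm (x - y) < d + iv n by exists v.
  move=> n; have n0 : 0 < iv n by rewrite invr_gt0 ltr0n.
  by have [_ [y My <-] yd] := inf_adherent n0 D0; exists y.
have inv_small (e : R) : 0 < e -> exists N : nat, forall n, (N <= n)%N -> iv n < e.
  move=> e0; exists (Num.truncn e^-1) => n Nn.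
  by rewrite /iv invf_plt ?posrE ?ltr0n// (lt_le_trans (truncnS_gt _))// ler_nat ltnS.
have close m n (e : R) : 0 < e -> rnorm (x - u m) < d + e -> rnorm (x - u n) < d + e ->
    rnorm (u m - u n) ^+ 2 <= 8 * d * e + 4 * e ^+ 2.
  move=> e0 hm hn; have [[Mm _] [Mn _]] := (uM m, uM n).
  set h : R[i] := (2^-1)%:C.
  have /dle mid : M (h *: u m + (h *: u n + 0)) by apply: (ML) => //; apply: (ML).
  have par : rnorm (u m - u n) ^+ 2 + 4 * rnorm (x - (h *: u m + (h *: u n + 0))) ^+ 2 =
      2 * rnorm (x - u m) ^+ 2 + 2 * rnorm (x - u n) ^+ 2.
    have -> : x - (h *: u m + (h *: u n + 0)) = h *: ((x - u m) + (x - u n)).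
      rewrite addr0 !scalerDr !scalerN addrACA -scalerDl -opprD -rmorphD /=.
      by rewrite (_ : 2^-1 + 2^-1 = 1) ?scale1r//; lra.
    have -> : u m - u n = (x - u n) - (x - u m) by rewrite opprB [RHS]addrC [RHS]addrA subrK.
    move: (x - u m) (x - u n) => p q.
    rewrite rnorm_sqrB rnormZr exprMn rnorm_sqrD (innerC q) ger0_norm ?invr_ge0//.
    by rewrite Re_conjC; field.
  have e1 : rnorm (x - u m) ^+ 2 <= (d + e) ^+ 2.
    by rewrite ler_sqr_rnorm ?(ltW hm) ?(ltW hn)// addr_ge0// ltW.
  have e2 : rnorm (x - u n) ^+ 2 <= (d + e) ^+ 2.
    by rewrite ler_sqr_rnorm ?(ltW hm) ?(ltW hn)// addr_ge0// ltW.
  have e3 : d ^+ 2 <= rnorm (x - (h *: u m + (h *: u n + 0))) ^+ 2.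
    by rewrite ler_pXn2r ?nnegrE ?rnorm_ge0.
  rewrite sqrrD mulr2n in e1 e2; move: par e1 e2 e3.
  clear; move: (rnorm _ ^+ 2) (rnorm _ ^+ 2) (rnorm _ ^+ 2) (rnorm _ ^+ 2) => *; nra.
have [l ul] : exists l, hlim u l.
  apply: hlim_cauchy => e e0.
  (* For [k <= 1], [8 d k + 4 k ^ 2] is less than [(8 d + 5) k]. *)
  pose k := Num.min 1 (e ^+ 2 / (8 * d + 5)).
  have den : 0 < 8 * d + 5 by lra.
  have k0 : 0 < k by rewrite lt_min ltr01 divr_gt0 ?exprn_gt0.
  have [N hN] := inv_small _ k0; exists N => m n Nm Nn.
  rewrite -(ltr_pXn2r (n:=2)) ?nnegrE ?rnorm_ge0 ?(ltW e0)//.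
  have kk : rnorm (u m - u n) ^+ 2 <= 8 * d * k + 4 * k ^+ 2.
    by apply: close => //; [case: (uM m) => _|case: (uM n) => _] => /lt_trans; apply;
      rewrite ltrD2l; exact: hN.
  apply: (le_lt_trans kk).
  have k1 : k <= 1 by rewrite ge_min lexx.
  have : k * (8 * d + 5) <= e ^+ 2 by rewrite -ler_pdivlMr// ge_min lexx orbT.
  move: k0 k1; clear; nra.
have Ml : M l.
  apply: Mcl => e e0; have [N hN] := ul _ e0; exists (u N); first by case: (uM N).
  by rewrite rnormB; exact: hN.
have xl : rnorm (x - l) <= d.
  suff xle (e : R) : 0 < e -> rnorm (x - l) <= d + e by apply/ler_addgt0Pr => e; exact: xle.
  move=> e0; have e2 : 0 < e / 2 by rewrite divr_gt0.
  have [N hN] := ul _ e2; have [K hK] := inv_small _ e2.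
  have h1 := hN _ (leq_maxl N K); have h2 := hK _ (leq_maxr N K).
  have [_ h3] := uM (maxn N K); have := ler_rnorm_dist x (u (maxn N K)) l; lra.
exists l => // z Mz; apply: orthogonal_of_min => a; apply: (le_trans xl).
by rewrite -addrA -opprD [l + _]addrC; apply: dle; apply: ML.
Qed.

(** Unless [phi = 0], its kernel misses some [x0]; a multiple of the component of
    [x0] orthogonal to the kernel represents [phi]. *)
Lemma riesz (phi : V -> R[i]) (c : R) :
  (forall a x y, phi (a *: x + y) = a * phi x + phi y) ->
  (forall x, cmod (phi x) <= c * rnorm x) ->
  exists z, forall x, phi x = '[x, z].
Proof.
move=> lphi bphi; have phi0 : phi 0 = 0.
  have := lphi 0 0 0; rewrite scaler0 addr0 mul0r add0r.
  have := lphi 1 0 0; rewrite scaler0 addr0 mul1r => /eqP.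
  by rewrite -subr_eq0 opprD addrA subrr add0r oppr_eq0 => /eqP.
have phiB x y : phi (x - y) = phi x - phi y.
  by rewrite addrC -scaleN1r lphi mulN1r addrC.
have [h|/existsNP[x0 x0n]] := pselect (forall x, phi x = 0).
  by exists 0 => x; rewrite h inner0r.
have [||m phim mo] := @projection_theorem [set x | phi x = 0]%classic _ _ x0.
- by split=> [//|a x y /= hx hy]; rewrite lphi hx hy mulr0 addr0.
- move=> x h /=; apply: contrapT => /eqP px0.
  have pp : 0 < cmod (phi x).
    by rewrite lt_def cmod_ge0 andbT; apply: contra_neqN px0 => /eqP /cmod_eq0.
  have c0 : 0 < `|c| + 1 by rewrite ltr_wpDl.
  have [y /= py] := h _ (divr_gt0 pp c0); rewrite ltr_pdivlMr// ltNge => /negP; apply.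
  have := bphi (x - y); rewrite phiB py subr0 => /le_trans; apply.
  by rewrite mulrC ler_wpM2l ?rnorm_ge0// (le_trans (ler_norm _))// lerDl.
pose w := x0 - m; have pw : phi w != 0 by rewrite phiB phim subr0; apply/eqP.
have ww : '[w, w] != 0.
  rewrite dnorm_eq0; apply: contraNneq pw => ->; exact/eqP.
exists ((phi w / '[w, w])^* *: w) => x; rewrite innerZr conjCK.
have /mo : phi (x - (phi x / phi w) *: w) = 0.
  by rewrite addrC -scaleNr lphi mulNr divfK// addNr.
rewrite innerC -/w => /(congr1 Num.conj); rewrite conjCK rmorph0 innerBl innerZl => /eqP.
rewrite subr_eq0 => /eqP ->; field; rewrite ww pw //.
Qed.

(** [adj] picks an arbitrary representing vector; the Riesz theorem provides one. *)
Lemma adjP (W : hilbertType R) (A : {bounded V -> W}) x y : '[A x, y] = '[x, adj A y].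
Proof.
suff ex : exists z, forall x, '[A x, y] = '[x, z].
  by move: x; rewrite /adj; exact: (xgetPex 0 ex).
have [c c0 Ac] := bounded_bound A.
apply: (@riesz (fun x => '[A x, y]) (c * rnorm y)) => [a u v|u].
  by rewrite linearP innerDl innerZl.
by apply: (le_trans (ler_cmod_inner _ _)); rewrite mulrAC ler_wpM2r ?rnorm_ge0.
Qed.

Lemma adj_unique (W : hilbertType R) (A : V -> W) (B : W -> V) :
  (forall x y, '[A x, y] = '[x, B y]) -> adj A =1 B.
Proof.
move=> h y; rewrite /adj; apply: (xget_unique 0) => [x|z hz]; first exact: h.
by apply: inner_extr => x; rewrite -hz -h.
Qed.

End projection.

Section adjoint.
Variables (R : realType) (V W : hilbertType R) (A : {bounded V -> W}).

Lemma adjPl x y : '[adj A x, y] = '[x, A y].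
Proof. by rewrite innerC -adjP -innerC. Qed.

Lemma adj_linear : linear (adj A).
Proof.
by move=> a x y; apply: inner_extr => z; rewrite -adjP !innerDr !innerZr !adjP.
Qed.

Lemma adj_bound : exists c : R, forall x, rnorm (adj A x) <= c * rnorm x.
Proof.
have [c c0 Ac] := bounded_bound A; exists c => x.
have [/eqP|] := eqVneq (rnorm (adj A x)) 0; first by move/eqP->; rewrite mulr_ge0 ?rnorm_ge0.
move=> n0; have n1 : 0 < rnorm (adj A x) by rewrite lt_def n0 rnorm_ge0.
rewrite -(ler_pM2l n1) -expr2 -ReinnerE -adjP (le_trans (ler_Re_cmod _))//.
rewrite (le_trans (ler_cmod_inner _ _))// mulrA (mulrC _ c) ler_wpM2r ?rnorm_ge0//.
Qed.

(** The adjoint as a bounded operator, so that adjoints can be iterated. *)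
Definition adjb : {bounded W -> V} := mk_bounded adj_linear adj_bound.

Lemma adjbE : adj A = adjb. Proof. by []. Qed.

End adjoint.

Lemma adjK (R : realType) (V W : hilbertType R) (A : {bounded V -> W}) :
  adj (adjb A) =1 A.
Proof. by apply: adj_unique => x y; rewrite -adjPl. Qed.

(** * Positive square roots *)

Section positive_operators.
Variables (R : realType) (V : hilbertType R).
Implicit Types A D : {bounded V -> V}.

Definition selfadjoint (W : hilbertType R) (A : W -> W) :=
  forall x y, '[A x, y] = '[x, A y].

Definition positive_op (W : hilbertType R) (A : W -> W) := forall x, 0 <= '[A x, x].

Lemma positive_real A x : positive_op A -> '[A x, x] = (Re '[A x, x])%:C.
Proof. by move=> A0; apply: real_conj; rewrite conj_Creal// ger0_real. Qed.

Lemma positive_Re A x : positive_op A -> 0 <= Re '[A x, x].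
Proof. by move=> A0; rewrite -ler0c -positive_real. Qed.

(** Polarization: the forms of [x + y] and [x + i y] being real, the values of
    the sesquilinear form at [(x, y)] and [(y, x)] are conjugate. *)
Lemma positive_selfadjoint A : positive_op A -> selfadjoint A.
Proof.
move=> A0 y x; have A1 z : '[A z, z]^* = '[A z, z] by rewrite conj_Creal// ger0_real.
have iN : ('i%C : R[i])^* = - 'i%C by apply/eqP; rewrite eq_complex /= oppr0 !eqxx.
have i0 : ('i%C : R[i]) != 0 by rewrite eq_complex /= oner_eq0 andbF.
have h1 := A1 (x + y); have h2 := A1 (x + 'i%C *: y).
rewrite !linearD linearZ /= !inner_expand in h1 h2.
rewrite [in RHS]innerC; move: h1 h2 (A1 x) (A1 y).
rewrite !rmorphD !rmorphM /= !conjCK !iN.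
move: '[A x, x] '[A x, y] '[A y, x] '[A y, y] => a c d b h1 h2 ax by_.
rewrite !ax !by_ in h1 h2.
have e1 : c^* + d^* = c + d.
  apply: (addrI (a + b)).
  have -> : a + b + (c^* + d^*) = a + d^* + (c^* + b) by ring.
  by rewrite h1; ring.
have e2 : c^* - d^* = d - c.
  apply: (mulfI i0); apply: (addrI (a - 'i%C * ('i%C * b))).
  have -> : a - 'i%C * ('i%C * b) + 'i%C * (c^* - d^*) =
      a + - 'i%C * d^* + ('i%C * c^* + - 'i%C * ('i%C * b)) by ring.
  by rewrite h2; ring.
have : 2 * d = 2 * c^*.
  have -> : 2 * c^* = (c^* + d^*) + (c^* - d^*) by ring.
  by rewrite e1 e2; ring.
by move/(mulfI _); apply; rewrite pnatr_eq0.
Qed.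

(** The form of [x - t A x] is nonnegative for every real [t]; for small positive
    [t] its dominant term is [- 2 t |A x| ^ 2]. *)
Lemma positive_kernel A x : positive_op A -> '[A x, x] = 0 -> A x = 0.
Proof.
move=> A0 Ax; have As := positive_selfadjoint A0; apply: rnorm_eq0.
set n := rnorm (A x); apply/eqP; rewrite -sqrf_eq0; apply/eqP.
set q := Re '[A (A x), A x]; have q0 : 0 <= q by exact: positive_Re.
have main (t : R) : 0 <= t ^+ 2 * q - 2 * t * n ^+ 2.
  have := positive_Re (x - t%:C *: A x) A0.
  have -> : A (x - t%:C *: A x) = A x - t%:C *: A (A x) by rewrite linearB linearZ.
  rewrite !inner_expand Ax (As (A x) x) innerrE -/n.
  rewrite conj_real.
  rewrite (positive_real (A x) A0) -/q.
  set e := (X in Re X); have -> // : e = (t ^+ 2 * q - 2 * t * n ^+ 2)%:C.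
  by rewrite /e; ring.
apply/eqP; rewrite eq_le exprn_ge0 ?rnorm_ge0// andbT leNgt; apply/negP => n0.
have q1 : 0 < q + 1 by lra.
(* Any [t] with [0 < t < 2 n ^ 2 / q] gives a contradiction. *)
have := main (n ^+ 2 / (q + 1)).
have -> : (n ^+ 2 / (q + 1)) ^+ 2 * q - 2 * (n ^+ 2 / (q + 1)) * n ^+ 2 =
  - (n ^+ 2 / (q + 1)) * (n ^+ 2 / (q + 1)) * (q + 2).
  by field; rewrite gt_eqF.
have t0 : 0 < n ^+ 2 / (q + 1) by rewrite divr_gt0.
have q2 : 0 < q + 2 by clear -q0; lra.
rewrite leNgt => /negP; apply; rewrite 2!mulNr oppr_lt0.
by rewrite mulr_gt0// mulr_gt0.
Qed.

(** If [A] and [D] are commuting positive square roots of the same operator and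
    [y = (A - D) x], then [(A + D) y = 0], so that [A y = D y = 0]. *)
Lemma positive_sqrt_unique A D : positive_op A -> positive_op D ->
  commuting_ops A D -> (forall x, A (A x) = D (D x)) -> A =1 D.
Proof.
move=> A0 D0 AD A2 x; set y := A x - D x.
have yy : '[A y, y] + '[D y, y] = 0.
  have yD : A y + D y = 0 by rewrite /y !linearB /= A2 (AD x) addrA subrK subrr.
  by rewrite -innerDl yD inner0l.
have [Ay Dy] : '[A y, y] = 0 /\ '[D y, y] = 0.
  move: yy; have := A0 y; have := D0 y; move: '[A y, y] '[D y, y] => a d d0 a0 /eqP.
  by rewrite paddr_eq0// => /andP[/eqP-> /eqP->].
apply/eqP; rewrite -subr_eq0; apply/eqP/inner_eq0; rewrite -/y {1}/y innerBl.
rewrite (positive_selfadjoint A0) (positive_selfadjoint D0).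
by rewrite (positive_kernel A0 Ay) (positive_kernel D0 Dy) !inner0r subrr.
Qed.

End positive_operators.

Section square_root.
Variable R : realType.

(** The iteration [Y -> (X + Y ^ 2) / 2], whose fixed point [Y] makes [1 - Y] a
    square root of [1 - X]. *)
Fixpoint sqrt_iter (V : lmodType R[i]) (X : V -> V) (n : nat) (x : V) : V :=
  if n is k.+1 then (2^-1 : R)%:C *: (X x + sqrt_iter X k (sqrt_iter X k x)) else 0.

(** The same iteration for the number [1] in place of [X]. *)
Fixpoint sqrt_majorant (n : nat) : R :=
  if n is k.+1 then 2^-1 * (1 + sqrt_majorant k ^+ 2) else 0.

Lemma sqrt_majorant_ge0 n : 0 <= sqrt_majorant n.
Proof. by elim: n => //= n IH; rewrite mulr_ge0 ?invr_ge0// addr_ge0// exprn_ge0. Qed.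

Lemma sqrt_majorant_le1 n : sqrt_majorant n <= 1.
Proof.
elim: n => [|n IH] /=; first exact: ler01.
have := sqrt_majorant_ge0 n; move: (sqrt_majorant n) IH => y; nra.
Qed.

Lemma sqrt_majorantS n : sqrt_majorant n <= sqrt_majorant n.+1.
Proof.
have := sqrt_majorant_le1 n; rewrite [sqrt_majorant n.+1]/=.
move: (sqrt_majorant n) => y; nra.
Qed.

Lemma sqrt_majorant_le m n : (m <= n)%N -> sqrt_majorant m <= sqrt_majorant n.
Proof.
move/subnK <-; elim: (n - m)%N => [|k IH] //.
by apply: (le_trans IH); exact: sqrt_majorantS.
Qed.

Lemma sqrt_iter_morph (V W : lmodType R[i]) (B : V -> W) (X : V -> V) (Y : W -> W) :
  linear B -> (forall x, B (X x) = Y (B x)) ->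
  forall n x, B (sqrt_iter X n x) = sqrt_iter Y n (B x).
Proof.
move=> lB BX; have B0 : B 0 = 0 by have := lB (-1) 0 0; rewrite !scaleN1r addr0 oppr0 addNr.
elim=> [|n IH] x //=; rewrite -[_ *: _]addr0 lB B0 addr0 -[X x]scale1r lB scale1r BX.
by rewrite !IH.
Qed.

Lemma sqrt_iter_linear (V : lmodType R[i]) (X : V -> V) n :
  linear X -> linear (sqrt_iter X n).
Proof.
move=> lX; elim: n => [|n IH] a x y /=; first by rewrite scaler0 addr0.
by rewrite lX IH IH !scalerDr !scalerA (mulrC a) addrACA.
Qed.

Section iteration.
Variables (V : hilbertType R) (X : V -> V).
Hypothesis lX : linear X.
Hypothesis cX : forall x, rnorm (X x) <= rnorm x.
Hypothesis sX : selfadjoint X.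

Let Y := sqrt_iter X.
Let y := sqrt_majorant.

Let YB n x z : Y n (x - z) = Y n x - Y n z.
Proof. by rewrite /Y [x - z]addrC -scaleN1r (sqrt_iter_linear n lX) scaleN1r addrC. Qed.

Lemma sqrt_iter_bound n x : rnorm (sqrt_iter X n x) <= sqrt_majorant n * rnorm x.
Proof.
elim: n x => [|n IH] x /=; first by rewrite rnorm0 mul0r.
rewrite rnormZr ger0_norm ?invr_ge0// -mulrA ler_wpM2l ?invr_ge0//.
apply: (le_trans (ler_rnormD _ _)); rewrite mulrDl mul1r lerD//.
by apply: (le_trans (IH _)); rewrite expr2 -mulrA ler_wpM2l ?sqrt_majorant_ge0.
Qed.

Lemma sqrt_iter_contraction n x : rnorm (sqrt_iter X n x) <= rnorm x.
Proof.
apply: (le_trans (sqrt_iter_bound n x)); rewrite -[leRHS]mul1r.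
by rewrite ler_wpM2r ?rnorm_ge0 ?sqrt_majorant_le1.
Qed.

(** From [Y ^ 2 - Z ^ 2 = Y (Y - Z) + (Y - Z) Z]: the increments of the operator
    iteration are dominated by those of the scalar one. *)
Lemma sqrt_iter_increment n x :
  rnorm (sqrt_iter X n.+1 x - sqrt_iter X n x) <=
  (sqrt_majorant n.+1 - sqrt_majorant n) * rnorm x.
Proof.
elim: n x => [|n IH] x.
  rewrite /= !subr0 addr0 rnormZr ger0_norm ?invr_ge0// -mulrA ler_wpM2l ?invr_ge0//.
  by rewrite expr0n /= addr0 mul1r.
rewrite -/Y -/y in IH *.
have -> : Y n.+2 x - Y n.+1 x = (2^-1 : R)%:C *:
    (Y n.+1 (Y n.+1 x - Y n x) + (Y n.+1 (Y n x) - Y n (Y n x))).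
  have -> : Y n.+2 x = (2^-1 : R)%:C *: (X x + Y n.+1 (Y n.+1 x)) by [].
  have -> : Y n.+1 x = (2^-1 : R)%:C *: (X x + Y n (Y n x)) by [].
  rewrite -/(Y n.+1 x) -scalerBr; congr (_ *: _).
  have -> : (2^-1 : R)%:C *: (X x + Y n (Y n x)) = Y n.+1 x by [].
  by rewrite YB addrA subrK opprD addrACA subrr add0r.
rewrite rnormZr ger0_norm ?invr_ge0//.
have -> : y n.+2 - y n.+1 = 2^-1 * (y n.+1 * (y n.+1 - y n) + (y n.+1 - y n) * y n).
  have -> : y n.+2 = 2^-1 * (1 + y n.+1 ^+ 2) by [].
  rewrite {2}[y n.+1](_ : _ = 2^-1 * (1 + y n ^+ 2)) //.
  by ring.
rewrite -mulrA ler_wpM2l ?invr_ge0//; apply: (le_trans (ler_rnormD _ _)).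
rewrite mulrDl lerD//.
  apply: (le_trans (sqrt_iter_bound _ _)); rewrite -mulrA.
  by rewrite ler_wpM2l ?sqrt_majorant_ge0.
apply: (le_trans (IH _)); rewrite -mulrA ler_wpM2l ?subr_ge0 ?sqrt_majorantS//.
exact: sqrt_iter_bound.
Qed.

Lemma sqrt_iter_dist m n x : (m <= n)%N ->
  rnorm (sqrt_iter X n x - sqrt_iter X m x) <= (y n - y m) * rnorm x.
Proof.
move/subnK <-; elim: (n - m)%N => [|k IH]; first by rewrite !subrr rnorm0 mul0r.
apply: (le_trans (ler_rnorm_dist _ (sqrt_iter X (k + m) x) _)).
rewrite addSn -(subrK (y (k + m)%N) (y (k + m).+1)) -addrA mulrDl lerD//.
exact: sqrt_iter_increment.
Qed.

Lemma sqrt_iter_cvg x : exists l, hlim (fun n => sqrt_iter X n x) l.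
Proof.
have cy (e : R) : 0 < e -> exists N, forall n, (N <= n)%N -> y n - y N < e.
  move=> e0; have hs : has_sup (range y).
    by split; [exists (y 0), 0%N|exists 1 => _ [n _ <-]; exact: sqrt_majorant_le1].
  have [_ [N _ <-] hN] := sup_adherent e0 hs; exists N => n _.
  by have : y n <= sup (range y) by [apply: ub_le_sup; [case: hs|exists n]]; lra.
apply: hlim_cauchy => e e0.
have x1 : 0 < rnorm x + 1 by rewrite ltr_wpDl ?rnorm_ge0.
have [N hN] := cy _ (divr_gt0 (divr_gt0 e0 x1) (ltr0Sn R 1)); exists N => m n Nm Nn.
have d k : (N <= k)%N -> rnorm (sqrt_iter X k x - sqrt_iter X N x) < e / 2.
  move=> Nk; apply: (le_lt_trans (sqrt_iter_dist x Nk)).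
  have := hN _ Nk; rewrite ltr_pdivlMr// ltr_pdivlMr// => h.
  rewrite ltr_pdivlMr//; apply: le_lt_trans h.
  rewrite mulrAC ler_wpM2l//; first by rewrite mulr_ge0// subr_ge0 sqrt_majorant_le.
  by rewrite lerDl.
have h1 := d _ Nm; have h2 := d _ Nn.
have := ler_rnorm_dist (sqrt_iter X m x) (sqrt_iter X N x) (sqrt_iter X n x).
by rewrite (rnormB (sqrt_iter X N x)); lra.
Qed.

(** The scalar iteration is increasing and bounded by [1], so the operator iteration
    converges strongly to some [Z] with [Z = (X + Z ^ 2) / 2], and [D = 1 - Z]. *)
Lemma sqrt_exists : exists D : {bounded V -> V},
  [/\ positive_op D, forall x, D (D x) = x - X x &
      forall x, hlim (fun n => sqrt_iter X n x) (x - D x)].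
Proof.
have [Z ZP] := choice sqrt_iter_cvg.
have Zb x : rnorm (Z x) <= rnorm x.
  rewrite -[Z x]subr0; apply: (hlim_le (ZP x)); exists 0%N => n _.
  by rewrite subr0 sqrt_iter_contraction.
have lZ : linear Z.
  move=> a x z; apply: (hlim_unique (ZP _)).
  have aP : hlim (fun n => a *: sqrt_iter X n x) (a *: Z x).
    apply: (hlim_bound (f := fun v => a *: v) (c := cmod a) _ (ZP x)) => u v.
    by rewrite -scalerBr rnormZc.
  by move=> e /(hlimD aP (ZP z))[N hN]; exists N => n /hN; rewrite (sqrt_iter_linear n lX).
have YS n : selfadjoint (sqrt_iter X n).
  elim: n => [|n IH] u v /=; first by rewrite inner0l inner0r.
  by rewrite !inner_expand conj_real sX IH IH.
have ZE x : Z x = (2^-1 : R)%:C *: (X x + Z (Z x)).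
  have S1 : hlim (fun n => sqrt_iter X n.+1 x) (Z x).
    by move=> e /(ZP x)[N hN]; exists N => n Nn; apply: hN; exact: leqW.
  apply: (hlim_unique S1) => e e0; have e2 : 0 < e / 2 by rewrite divr_gt0.
  have [N hN] := ZP x _ e2; have [M hM] := ZP (Z x) _ e2.
  exists (maxn N M) => n; rewrite geq_max => /andP[/hN h1 /hM h2] /=.
  rewrite -scalerBr opprD addrACA subrr add0r rnormZr ger0_norm ?invr_ge0//.
  have := ler_rnorm_dist (sqrt_iter X n (sqrt_iter X n x)) (sqrt_iter X n (Z x)) (Z (Z x)).
  rewrite -YB; have := sqrt_iter_contraction n (sqrt_iter X n x - Z x).
  have := rnorm_ge0 (sqrt_iter X n (sqrt_iter X n x) - Z (Z x)).
  rewrite -/Y in h1 h2 *; lra.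
pose D0 x := x - Z x.
have lD : linear D0.
  by move=> a x z; rewrite /D0 lZ scalerBr opprD addrACA.
have bD : exists c : R, forall x, rnorm (D0 x) <= c * rnorm x.
  by exists 2 => x; apply: (le_trans (ler_rnormB _ _)); rewrite mulr_natl mulr2n lerD.
exists (mk_bounded lD bD); split => [x|x|x]; rewrite ?mk_boundedE /D0.
- have ZS : '[Z x, x]^* = '[Z x, x].
    rewrite -innerC; apply/eqP; rewrite -subr_eq0; apply/eqP/cmod_eq0.
    apply/eqP; rewrite eq_le cmod_ge0 andbT; apply/ler_addgt0Pr => e e0; rewrite add0r.
    have x1 : 0 < 2 * (rnorm x + 1) by have := rnorm_ge0 x; lra.
    have [N /(_ N (leqnn N))] := ZP x _ (divr_gt0 e0 x1).
    rewrite ltr_pdivlMr// => h.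
    have -> : '[x, Z x] - '[Z x, x] =
      '[x, Z x - sqrt_iter X N x] + '[sqrt_iter X N x - Z x, x].
      by rewrite innerBr innerBl YS addrA subrK.
    apply: (le_trans (cmodD _ _)).
    have h1 := ler_cmod_inner x (Z x - sqrt_iter X N x).
    have h2 := ler_cmod_inner (sqrt_iter X N x - Z x) x.
    rewrite rnormB in h1; have := rnorm_ge0 (sqrt_iter X N x - Z x).
    have := rnorm_ge0 x; move: h h1 h2.
    move: (rnorm _) (rnorm _) (cmod _) (cmod _); clear => *; nra.
  rewrite innerBl (real_conj ZS) innerrE -rmorphB ler0c subr_ge0.
  apply: (le_trans (ler_Re_cmod _)); apply: (le_trans (ler_cmod_inner _ _)).
  by rewrite expr2 ler_wpM2r ?rnorm_ge0.
- have ZB u v : Z (u - v) = Z u - Z v by rewrite addrC -scaleN1r lZ scaleN1r addrC.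
  have C2 : (2%:C : R[i]) = 1 + 1 by rewrite -[1 in RHS](rmorph1 (real_complex R)) -rmorphD.
  have -> : Z (x - Z x) = Z x - Z (Z x) by exact: ZB.
  have -> : Z (Z x) = Z x + Z x - X x.
    have -> : Z x + Z x = 2%:C *: Z x by rewrite C2 scalerDl scale1r.
    by rewrite {2}(ZE x) scalerA -rmorphM /= mulfV ?pnatr_eq0// scale1r addrAC subrr add0r.
  by rewrite opprB [_ - Z x in X in _ + X]addrAC addrK addrA subrK.
- by rewrite opprB addrC subrK; exact: ZP.
Qed.

(** [sqrt_op] is an arbitrary positive square root [D] of [1 - X].  As
    [X = 1 - D ^ 2], it commutes with [X], hence with the limit of the iteration,
    and uniqueness identifies the two. *)
Lemma sqrt_opP (D := sqrt_op (fun x => x - X x)) :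
  [/\ positive_op D, forall x, D (D x) = x - X x &
      forall x, hlim (fun n => sqrt_iter X n x) (x - D x)].
Proof.
have [E [E0 E2 El]] := sqrt_exists.
have [D0 D2] : positive_op D /\ forall x, D (D x) = x - X x.
  rewrite /D /sqrt_op.
  have := @xgetPex _ (bounded_zero V V) [set D : {bounded V -> V} |
    (forall x, 0 <= '[D x, x]) /\ (forall x, D (D x) = x - X x)]%classic.
  by apply; exists E.
have XE x : X x = x - D (D x) by rewrite D2 opprB addrC subrK.
have DX x : D (X x) = X (D x) by rewrite !XE linearB.
have DE : commuting_ops D E.
  move=> x; have h1 := hlim_bounded D (El x); have h2 := El (D x).
  have h3 : D (x - E x) = D x - E (D x).
    apply: (hlim_unique h1) => e /h2[N hN]; exists N => n /hN /=.
    by rewrite (sqrt_iter_morph (B := D) (Y := X))//; exact: bounded_linearW.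
  by move: h3; rewrite linearB => /addrI/oppr_inj.
have DEx : D =1 E by apply: positive_sqrt_unique => // x; rewrite D2 E2.
by split=> // x; rewrite DEx.
Qed.

End iteration.

(** Square roots being limits of the same polynomials in [X], they inherit
    intertwining relations. *)
Lemma sqrt_op_morph (V W : hilbertType R) (X : V -> V) (Z : W -> W) (B : {bounded V -> W}) :
  linear X -> (forall x, rnorm (X x) <= rnorm x) -> selfadjoint X ->
  linear Z -> (forall x, rnorm (Z x) <= rnorm x) -> selfadjoint Z ->
  (forall x, B (X x) = Z (B x)) ->
  forall x, B (sqrt_op (fun x => x - X x) x) = sqrt_op (fun x => x - Z x) (B x).
Proof.
move=> lX cX sX lZ cZ sZ BX x.
have [_ _ /(_ x)/(hlim_bounded B) h1] := sqrt_opP lX cX sX.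
have [_ _ /(_ (B x)) h2] := sqrt_opP lZ cZ sZ.
have : B (x - sqrt_op (fun x => x - X x) x) = B x - sqrt_op (fun x => x - Z x) (B x).
  apply: (hlim_unique h1) => e /h2[N hN]; exists N => n /hN /=.
  by rewrite (sqrt_iter_morph (B := B) (Y := Z))//; exact: bounded_linearW.
by rewrite linearB => /addrI/oppr_inj.
Qed.

End square_root.

(** * Joint approximate eigenvalues of commuting self-adjoint operators *)

Section operator_algebra.
Variable R : realType.

Lemma comp_linear (U V W : lmodType R[i]) (A : V -> W) (B : U -> V) :
  linear A -> linear B -> linear (A \o B).
Proof. by move=> lA lB a x y /=; rewrite lB lA. Qed.

Lemma comb_linear (V W : lmodType R[i]) (a b : R[i]) (A B : V -> W) :
  linear A -> linear B -> linear (fun x => a *: A x + b *: B x).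
Proof.
by move=> lA lB c x y /=; rewrite lA lB !scalerDr !scalerA (mulrC a) (mulrC b) addrACA.
Qed.

Lemma comp_bound (U V W : hilbertType R) (A : {bounded V -> W}) (B : {bounded U -> V}) :
  exists c : R, forall x, rnorm ((A \o B) x) <= c * rnorm x.
Proof.
have [a a0 Aa] := bounded_bound A; have [b b0 Bb] := bounded_bound B.
by exists (a * b) => x; apply: (le_trans (Aa _)); rewrite -mulrA ler_wpM2l.
Qed.

Lemma comb_bound (V W : hilbertType R) (a b : R[i]) (A B : {bounded V -> W}) :
  exists c : R, forall x, rnorm (a *: A x + b *: B x) <= c * rnorm x.
Proof.
have [c _ Ac] := bounded_bound A; have [d _ Bd] := bounded_bound B.
exists (cmod a * c + cmod b * d) => x; apply: (le_trans (ler_rnormD _ _)).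
by rewrite !rnormZc mulrDl -!mulrA lerD// ler_wpM2l ?cmod_ge0.
Qed.

Definition comp_op (U V W : hilbertType R) (A : {bounded V -> W}) (B : {bounded U -> V}) :
    {bounded U -> W} :=
  mk_bounded (comp_linear (bounded_linearW A) (bounded_linearW B)) (comp_bound A B).

Definition comb_op (V W : hilbertType R) (a : R[i]) (A : {bounded V -> W}) (b : R[i])
    (B : {bounded V -> W}) : {bounded V -> W} :=
  mk_bounded (comb_linear a b (bounded_linearW A) (bounded_linearW B)) (comb_bound a b A B).

Lemma comp_opE (U V W : hilbertType R) (A : {bounded V -> W}) (B : {bounded U -> V}) x :
  comp_op A B x = A (B x).
Proof. by []. Qed.

Lemma comb_opE (V W : hilbertType R) a (A : {bounded V -> W}) b (B : {bounded V -> W}) x :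
  comb_op a A b B x = a *: A x + b *: B x.
Proof. by []. Qed.

Variable V : hilbertType R.
Implicit Types A B C : {bounded V -> V}.

Lemma id_bound : exists c : R, forall x : V, rnorm (id x) <= c * rnorm x.
Proof. by exists 1 => x; rewrite mul1r. Qed.

Definition id_op : {bounded V -> V} :=
  mk_bounded ((fun a x y => erefl) : linear (@id V)) id_bound.

Lemma id_opE x : id_op x = x. Proof. by []. Qed.

Definition commutant (G : set {bounded V -> V}) : set {bounded V -> V} :=
  [set B | forall C, G C -> commuting_ops B C]%classic.

(** The bicommutant stands for the functions of the operators in [G]. *)
Definition bicommutant (G : set {bounded V -> V}) := commutant (commutant G).

Lemma bicommutant_comp G A B :
  bicommutant G A -> bicommutant G B -> bicommutant G (comp_op A B).
Proof. by move=> hA hB C hC x; rewrite !comp_opE (hB _ hC) (hA _ hC). Qed.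

Lemma bicommutant_comb G a A b B :
  bicommutant G A -> bicommutant G B -> bicommutant G (comb_op a A b B).
Proof.
move=> hA hB C hC x; rewrite !comb_opE (hA _ hC) (hB _ hC).
by rewrite boundedD !boundedZ.
Qed.

Lemma bicommutant_sub (G : set {bounded V -> V}) A : G A -> bicommutant G A.
Proof. by move=> GA C hC x; rewrite (hC _ GA). Qed.

(** The modulus of a self-adjoint contraction [C], as a square root of [C ^ 2]. *)
Lemma modulus_exists C : selfadjoint C -> (forall x, rnorm (C x) <= rnorm x) ->
  exists D : {bounded V -> V}, [/\ positive_op D, forall x, D (D x) = C (C x)
    & forall B, commuting_ops B C -> commuting_ops B D].
Proof.
move=> sC cC; pose X x := x - C (C x).
have lX : linear X.
  move=> a x y; rewrite /X; have -> : C (C (a *: x + y)) = a *: C (C x) + C (C y).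
    by rewrite !boundedP.
  by rewrite scalerBr opprD addrACA.
have sX : selfadjoint X by move=> x y; rewrite /X innerBl innerBr !sC.
have cX x : rnorm (X x) <= rnorm x.
  rewrite -ler_sqr_rnorm ?rnorm_ge0// /X rnorm_sqrB -sC -ReinnerE.
  have : rnorm (C (C x)) ^+ 2 <= rnorm (C x) ^+ 2.
    by rewrite ler_sqr_rnorm ?rnorm_ge0.
  have := sqr_ge0 (rnorm (C x)); rewrite !ReinnerE; lra.
have [D0 D2 _] := sqrt_opP lX cX sX.
exists (sqrt_op (fun x => x - X x)); split=> // [x|B BC x].
  by rewrite D2 /X opprB addrC subrK.
rewrite (sqrt_op_morph (B := B) lX cX sX lX cX sX)// => y.
by rewrite /X boundedB !BC.
Qed.

End operator_algebra.

Section localization.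
Variables (R : realType) (V : hilbertType R) (G : set {bounded V -> V}).
Hypothesis G_commutes : forall A B, G A -> G B -> commuting_ops A B.
Implicit Types (A B C D : {bounded V -> V}) (M : set V).

(** Hyperinvariant subspaces play the role of spectral subspaces: they can be cut
    by the sign of any operator of the bicommutant, and the pieces are again
    hyperinvariant. *)
Definition hyperinvariant M :=
  subspace_set M /\ forall B, commutant G B -> forall x, M x -> M (B x).

Lemma bicommutant_commutant A : bicommutant G A -> commutant G A.
Proof. by move=> hA B GB x; rewrite (hA B) // => C GC; exact: G_commutes. Qed.

(** The piece of [M] where [A >= t] consists of the vectors on which the modulus
    of [A - t] agrees with [A - t]; it contains [(|A - t| + (A - t)) M]. *)
Lemma hyperinvariant_cut A M (t : R) y : selfadjoint A -> bicommutant G A ->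
  hyperinvariant M -> M y -> t * rnorm y ^+ 2 < Re '[A y, y] ->
  exists M', [/\ hyperinvariant M', (M' `<=` M)%classic, exists2 x, M' x & x <> 0
    & forall x, M' x -> t * rnorm x ^+ 2 <= Re '[A x, x]].
Proof.
move=> sA hA [[M0 ML] Minv] My yt.
have [c c0 Ac] := bounded_bound A.
(* [k] bounds the norm of [A - t], which makes [C = (A - t) / k] a contraction. *)
pose k := c + `|t| + 1.
have k0 : 0 < k by rewrite ltr_wpDl// addr_ge0.
have [C CE] : exists C : {bounded V -> V}, forall x, C x = (k^-1)%:C *: (A x - t%:C *: x).
  exists (comb_op (k^-1)%:C A (- (k^-1 * t))%:C (id_op V)) => x.
  by rewrite comb_opE id_opE scalerBr scalerA -rmorphM rmorphN scaleNr.
have sC : selfadjoint C.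
  by move=> u v; rewrite !CE !inner_expand !conj_real sA.
have cC x : rnorm (C x) <= rnorm x.
  rewrite CE rnormZr gtr0_norm ?invr_gt0// ler_pdivrMl//.
  apply: (le_trans (ler_rnormB _ _)); rewrite rnormZr.
  have := Ac x; have := rnorm_ge0 x; rewrite /k; nra.
have hC B : commutant G B -> commuting_ops B C.
  by move=> hB x; rewrite !CE boundedZ boundedB boundedZ (hA _ hB).
have [D [D0 D2 hD]] := modulus_exists sC cC.
have CRe x : Re '[C x, x] = k^-1 * (Re '[A x, x] - t * rnorm x ^+ 2).
  rewrite CE !inner_expand innerrE; case: '[A x, x] => u v /=; ring.
have DC x : D (C x) = C (D x) by rewrite -(hD C).
have hDG : commutant G D.
  move=> B GB x; rewrite -(hD B)// => z; rewrite hC// => B' GB'; exact: G_commutes.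
have hCG : commutant G C.
  by move=> B GB x; rewrite -(hC B)// => B' GB'; exact: G_commutes.
exists [set x | M x /\ D x = C x]%classic; split.
- split=> [|B hB x [Mx Dx]]; first split=> [|a x z [Mx Dx] [Mz Dz]].
  + by split; rewrite ?bounded0.
  + by split; [exact: ML|rewrite !boundedP Dx Dz].
  + split; first exact: Minv.
    by rewrite -(hD B) ?Dx ?hC//; exact: hC.
- by move=> x [].
- exists (D y + C y).
    split; last by rewrite !boundedD D2 DC addrC.
    by rewrite -[D y]scale1r; apply: (ML); exact: Minv.
  move/eqP; rewrite addrC addr_eq0 => /eqP Cy.
  move: yt; rewrite -subr_gt0 -(pmulr_rgt0 _ (x := k^-1)) ?invr_gt0// -CRe Cy.
  by rewrite innerNl raddfN oppr_gt0 ltNge positive_Re.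
- move=> x [Mx Dx]; rewrite -subr_ge0 -(pmulr_rge0 _ (x := k^-1)) ?invr_gt0//.
  by rewrite -CRe -Dx positive_Re.
Qed.

(** A form pinched between [0] and [d] forces the operator norm below [d]: with
    [z = d y - B y], add the inequalities [<(d - B) B y, B y> >= 0] and
    [<B z, z> >= 0]. *)
Lemma pinched_bound B M (d : R) : 0 < d -> subspace_set M -> selfadjoint B ->
  (forall x, M x -> M (B x)) ->
  (forall x, M x -> 0 <= Re '[B x, x] <= d * rnorm x ^+ 2) ->
  forall x, M x -> rnorm (B x) <= d * rnorm x.
Proof.
move=> d0 [M0 ML] sB Binv hB y My.
have /andP[_ h1] := hB _ (Binv _ My); have /andP[_ h2] := hB _ My.
have Mz : M (d%:C *: y + (-1) *: B y + 0).
  rewrite -addrA; apply: (ML) => //; rewrite scaleN1r addr0 -scaleN1r -[_ *: _]addr0.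
  by apply: ML => //; exact: Binv.
have /andP[h3 _] := hB _ Mz; move: h3; rewrite addr0 boundedD !boundedZ.
rewrite !inner_expand !rmorphN !rmorph1 !conj_real (sB (B y) y) innerrE => h3.
rewrite -ler_sqr_rnorm ?mulr_ge0 ?rnorm_ge0 ?(ltW d0)// exprMn.
move: h1 h2 h3 d0; rewrite /=; case: '[B y, y] => a a'; case: '[B (B y), B y] => c c'.
rewrite /=; move: (rnorm (B y) ^+ 2) (rnorm y ^+ 2) => b n; clear => h1 h2 h3 d0.
have {}h3 : d * b <= d * (d * a) by lra.
have {}h3 : b <= d * a by rewrite -(ler_pM2l d0).
have : d * a <= d * (d * n) by rewrite ler_pM2l.
by move=> h4; rewrite expr2 -mulrA (le_trans h3).
Qed.

Definition nontrivial_hyperinvariant M := hyperinvariant M /\ exists2 x, M x & x <> 0.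

(** Cut [M] just below the top of the numerical range of [A] on [M]. *)
Lemma localize A M (d : R) : 0 < d -> selfadjoint A -> bicommutant G A ->
  nontrivial_hyperinvariant M ->
  exists M' m, [/\ nontrivial_hyperinvariant M', (M' `<=` M)%classic
    & forall x, M' x -> rnorm (A x - m%:C *: x) <= d * rnorm x].
Proof.
move=> d0 sA hA [hM [y0 My0 y0n]]; have [[M0 ML] Minv] := hM.
have [c c0 Ac] := bounded_bound A.
pose N := [set Re '[A x, x] | x in [set x | M x /\ rnorm x = 1]]%classic.
have unit y : M y -> y <> 0 ->
    exists2 x, M x /\ rnorm x = 1 & Re '[A x, x] * rnorm y ^+ 2 = Re '[A y, y].
  move=> My /rnorm_gt0 yp; exists ((rnorm y)^-1%:C *: y).
    split; first by rewrite -[_ *: _]addr0; exact: ML.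
    by rewrite rnormZr gtr0_norm ?invr_gt0// mulVf// gt_eqF.
  rewrite boundedZ innerZl innerZr conj_real; case: '[A y, y] => a b /=.
  by rewrite !mul0r !subr0; field; rewrite gt_eqF.
have hN : has_sup N.
  split; first by have [x xM _] := unit _ My0 y0n; exists (Re '[A x, x]), x.
  exists c => _ [x [_ x1] <-]; apply: (le_trans (ler_Re_cmod _)).
  by apply: (le_trans (ler_cmod_inner _ _)); have := Ac x; rewrite x1 !mulr1.
pose m := sup N.
have upper x : M x -> Re '[A x, x] <= m * rnorm x ^+ 2.
  have [->|/eqP x0] := eqVneq x 0; first by rewrite inner0r rnorm0 expr0n mulr0.
  move=> Mx; have [u uM <-] := unit _ Mx x0; rewrite ler_wpM2r ?exprn_ge0 ?rnorm_ge0//.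
  by apply: ub_le_sup; [case: hN|exists u].
have [_ [y [My y1] <-] ym] := sup_adherent d0 hN.
have [|M' [hM' M'M M'n low]] := hyperinvariant_cut (t := m - d) sA hA hM My.
  by rewrite y1 expr1n mulr1.
exists M', m; split=> //; have [[M'0 M'L] M'inv] := hM'.
have [B BE] : exists B : {bounded V -> V}, forall x, B x = m%:C *: x - A x.
  by exists (comb_op (-1) A m%:C (id_op V)) => x; rewrite comb_opE id_opE scaleN1r addrC.
have BRe x : Re '[B x, x] = m * rnorm x ^+ 2 - Re '[A x, x].
  by rewrite BE !inner_expand innerrE; case: '[A x, x] => u v /=; ring.
move=> x M'x; rewrite rnormB -BE.
apply: (@pinched_bound B M') => // [u v|u M'u|u M'u].
- by rewrite !BE !inner_expand conj_real sA.
- rewrite BE -scaleN1r; apply: (M'L) => //; rewrite -[_ *: _]addr0; apply: (M'L) => //.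
  by apply: M'inv => //; exact: bicommutant_commutant.
- rewrite BRe; have := low _ M'u; have := upper _ (M'M _ M'u).
  move: (Re _) (rnorm _ ^+ 2) => a n h1 h2; apply/andP; split; lra.
Qed.

Lemma localize_family (A : nat -> {bounded V -> V}) N M (d : R) : 0 < d ->
  (forall k, selfadjoint (A k)) -> (forall k, bicommutant G (A k)) ->
  nontrivial_hyperinvariant M ->
  exists M' (m : nat -> R), [/\ nontrivial_hyperinvariant M', (M' `<=` M)%classic
    & forall k, (k < N)%N -> forall x, M' x -> rnorm (A k x - (m k)%:C *: x) <= d * rnorm x].
Proof.
move=> d0 sA hA hM; elim: N => [|N [M1 [m [h1 M1M loc]]]].
  by exists M, (fun=> 0); split.
have [M2 [l [h2 M2M1 loc2]]] := localize d0 (sA N) (hA N) h1.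
exists M2, (fun k => if k == N then l else m k); split=> //.
  by move=> x /M2M1/M1M.
move=> k; rewrite ltnS leq_eqVlt; case: eqP => [-> _ x|kN /= kN' x /M2M1]; first exact: loc2.
exact: loc.
Qed.

(** Localizing again and again inside the previous piece, with errors decreasing
    to [0], makes the approximate eigenvalues converge. *)
Lemma joint_approximate_eigenvalue (A : nat -> {bounded V -> V}) N M (d : nat -> R) :
  (forall n, 0 < d n) -> (forall n p, (n <= p)%N -> d p <= d n) ->
  (forall k, selfadjoint (A k)) -> (forall k, bicommutant G (A k)) ->
  nontrivial_hyperinvariant M ->
  exists (m : nat -> R) (w : nat -> V), forall n, [/\ M (w n), rnorm (w n) = 1
    & forall k, (k < N)%N -> rnorm (A k (w n) - (m k)%:C *: w n) <= d n].
Proof.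
move=> d0 dle sA hA hM.
(* One third of the error is for the distance of [A k x] to the [n]-th centre, two
   thirds are for the drift of the later centres. *)
have d3 n : 0 < d n / 3 by rewrite divr_gt0.
have step (p : nat * {M' | nontrivial_hyperinvariant M'}) :
    {q : {M' | nontrivial_hyperinvariant M'} * (nat -> R) |
    (sval q.1 `<=` sval p.2)%classic /\ forall k, (k < N)%N -> forall x, sval q.1 x ->
      rnorm (A k x - (q.2 k)%:C *: x) <= d p.1 / 3 * rnorm x}.
  apply: cid; have [M' [m [h1 h2 h3]]] := localize_family N (d3 p.1) sA hA (svalP p.2).
  by exists (exist _ M' h1, m).
pose Ms := fix Ms n := if n is k.+1 then (sval (step (k, Ms k))).1 else exist _ M hM.
pose ms n := (sval (step (n, Ms n))).2.
have sub1 n : (sval (Ms n.+1) `<=` sval (Ms n))%classic.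
  by have [] := svalP (step (n, Ms n)).
have sub n p : (n <= p)%N -> (sval (Ms p) `<=` sval (Ms n))%classic.
  by move/subnK <-; elim: (p - n)%N => [|j IH] // x; rewrite addSn => /sub1/IH.
have loc n k x : (k < N)%N -> sval (Ms n.+1) x ->
    rnorm (A k x - (ms n k)%:C *: x) <= d n / 3 * rnorm x.
  by move=> kN; have [_ /(_ _ kN)] := svalP (step (n, Ms n)); exact.
have [w wP] : exists w : nat -> V, forall n, sval (Ms n.+1) (w n) /\ rnorm (w n) = 1.
  suff /choice[w hw] : forall n, exists x, sval (Ms n.+1) x /\ rnorm x = 1 by exists w.
  move=> n; have [[[M'0 M'L] _] [x M'x /rnorm_gt0 x0]] := svalP (Ms n.+1).
  exists ((rnorm x)^-1%:C *: x); split; first by rewrite -[_ *: _]addr0; exact: M'L.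
  by rewrite rnormZr gtr0_norm ?invr_gt0// mulVf// gt_eqF.
have near n p k : (n <= p)%N -> (k < N)%N -> `|ms n k - ms p k| <= 2 * (d n / 3).
  move=> np kN; have [wp w1] := wP p.
  have h1 := loc _ _ _ kN wp; have h2 := loc _ _ _ kN (@sub n.+1 p.+1 np _ wp).
  have -> : `|ms n k - ms p k| = rnorm ((ms n k)%:C *: w p - (ms p k)%:C *: w p).
    by rewrite -scalerBl -rmorphB rnormZr w1 mulr1.
  have := ler_rnorm_dist ((ms n k)%:C *: w p) (A k (w p)) ((ms p k)%:C *: w p).
  rewrite (rnormB _ (A k (w p))); rewrite w1 !mulr1 in h1 h2; have := dle _ _ np; lra.
have lim k : exists l, (k < N)%N -> forall n, `|l - ms n k| <= 2 * (d n / 3).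
  have [kN|] := boolP (k < N)%N; last by exists 0.
  (* The intervals around the centres meet pairwise, hence all together. *)
  pose S := range (fun n => ms n k - 2 * (d n / 3)).
  have cross n p : ms n k - 2 * (d n / 3) <= ms p k + 2 * (d p / 3).
    case/orP: (leq_total n p) => /near/(_ kN); rewrite ler_norml => /andP[h1 h2].
      by have := d3 p; lra.
    by have := d3 n; lra.
  have hS : has_sup S.
    split; first by exists (ms 0%N k - 2 * (d 0%N / 3)), 0%N.
    by exists (ms 0%N k + 2 * (d 0%N / 3)) => _ [n _ <-].
  exists (sup S) => _ n; rewrite ler_norml; apply/andP; split.
    by have : ms n k - 2 * (d n / 3) <= sup S by [apply: ub_le_sup; [case: hS|exists n]]; lra.
  have : sup S <= ms n k + 2 * (d n / 3) by apply: ge_sup; [case: hS|move=> _ [p _ <-]].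
  lra.
have [m mP] := choice lim; exists m, w => n; have [wn w1] := wP n.
split=> [||k kN] //; first by have := sub 0%N n.+1 (leq0n _) _ wn.
have -> : A k (w n) - (m k)%:C *: w n =
    (A k (w n) - (ms n k)%:C *: w n) - ((m k - ms n k)%:C *: w n).
  by rewrite rmorphB scalerBl opprB addrA subrK.
apply: (le_trans (ler_rnormB _ _)); rewrite rnormZr w1 mulr1.
have := loc _ _ _ kN wn; have := mP _ kN n; rewrite w1 mulr1; lra.
Qed.

End localization.

(** * Points of the joint spectrum *)

Section gliding_hump.
Variables (R : realType) (V : hilbertType R) (w : nat -> V).
Hypothesis w1 : forall n, rnorm (w n) = 1.

(** The ratio [1 / 3] makes all the later steps together at most half of a step. *)
Definition hump_scale (n : nat) : R := (3^-1) ^+ n.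

Lemma hump_scale_gt0 n : 0 < hump_scale n.
Proof. by rewrite exprn_gt0// invr_gt0. Qed.

Lemma hump_scaleS n : hump_scale n.+1 = hump_scale n / 3.
Proof. by rewrite /hump_scale exprSr. Qed.

Lemma hump_scale_small (e : R) : 0 < e -> exists N, hump_scale N < e.
Proof.
move=> e0; have le n : hump_scale n * n.+1%:R <= 1.
  elim: n => [|n IH]; first by rewrite /hump_scale expr0 mul1r.
  have := hump_scale_gt0 n; rewrite hump_scaleS -[n.+2%:R]natr1.
  have : 1 <= n.+1%:R :> R by rewrite ler1n.
  move: IH; move: (hump_scale n) (n.+1%:R : R) => a b; nra.
exists (Num.truncn e^-1); set N := Num.truncn _.
have eN : 1 < e * N.+1%:R by rewrite mulrC -ltr_pdivrMr// mul1r truncnS_gt.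
rewrite -(ltr_pM2r (x := N.+1%:R)) ?ltr0n//; exact: le_lt_trans (le N) eN.
Qed.

(** The sign of each step is chosen so that the new partial sum has an inner
    product of modulus at least [hump_scale n] with [w n]. *)
Fixpoint hump (n : nat) : V :=
  if n is k.+1 then
    let x := hump k + (hump_scale k)%:C *: w k in
    if hump_scale k <= cmod '[x, w k] then x else hump k - (hump_scale k)%:C *: w k
  else 0.

Lemma hump_step n : rnorm (hump n.+1 - hump n) = hump_scale n.
Proof.
have s0 := hump_scale_gt0 n; rewrite /=; case: ifP => _; rewrite addrAC subrr add0r ?rnormN;
  by rewrite rnormZr w1 mulr1 gtr0_norm.
Qed.

Lemma hump_inner n : hump_scale n <= cmod '[hump n.+1, w n].
Proof.
rewrite /=; case: ifP => // /negbT; rewrite -ltNge => h.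
set a := hump_scale n in h *; set z := '[hump n - a%:C *: w n, w n].
have : cmod (2 * a)%:C = 2 * a by rewrite cmod_real ger0_norm// mulr_ge0// ltW// hump_scale_gt0.
have -> : (2 * a)%:C = '[hump n + a%:C *: w n, w n] + - z.
  rewrite /z !inner_expand innerrE w1 expr1n; ring.
move=> e; have := cmodD '[hump n + a%:C *: w n, w n] (- z); rewrite e cmodN; lra.
Qed.

Lemma hump_dist n p : (n < p)%N -> rnorm (hump p - hump n.+1) <= 2^-1 * hump_scale n.
Proof.
move/subnK <-; set j := (p - n.+1)%N.
suff : rnorm (hump (j + n.+1) - hump n.+1) <= 2^-1 * (hump_scale n - hump_scale (j + n)).
  move/le_trans; apply; rewrite ler_wpM2l ?invr_ge0// gerBl ltW//; exact: hump_scale_gt0.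
elim: j => [|j IH]; first by rewrite !subrr rnorm0 mulr0.
rewrite addSn; apply: (le_trans (ler_rnorm_dist _ (hump (j + n.+1)) _)).
rewrite hump_step; move: IH; rewrite addSn addnS !hump_scaleS; lra.
Qed.

(** A quantitative form of the uniform boundedness principle. *)
Lemma gliding_hump : exists z, forall n, 2^-1 * hump_scale n <= cmod '[z, w n].
Proof.
have [z zP] : exists z, hlim hump z.
  apply: hlim_cauchy => e e0; have [N hN] := hump_scale_small e0.
  exists N.+1 => m n Nm Nn.
  have h1 := hump_dist Nm; have h2 := hump_dist Nn.
  have := ler_rnorm_dist (hump m) (hump N.+1) (hump n); rewrite (rnormB (hump N.+1)); lra.
exists z => n.
have h : rnorm (z - hump n.+1) <= 2^-1 * hump_scale n.
  by apply: (hlim_le zP); exists n.+1 => p; exact: hump_dist.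
have h2 := hump_inner n; have h3 := ler_cmod_inner (hump n.+1 - z) (w n).
have -> : '[z, w n] = '[hump n.+1, w n] - '[hump n.+1 - z, w n] by rewrite !inner_expand; ring.
have := cmodD ('[hump n.+1, w n] - '[hump n.+1 - z, w n]) '[hump n.+1 - z, w n].
by rewrite subrK; rewrite w1 mulr1 rnormB in h3; lra.
Qed.

End gliding_hump.

Section gamma_unitaries.
Variables (R : realType) (K : hilbertType R).
Implicit Types (A B T U : {bounded K -> K}).

(** [A - s] is normal together with [A]. *)
Lemma normal_dist A (s : R[i]) x : normal_op A ->
  rnorm (adj A x - s^* *: x) = rnorm (A x - s *: x).
Proof.
move=> nA; apply: rnorm_inner; rewrite !inner_expand conjCK.
have -> : '[adj A x, adj A x] = '[A x, A x] by rewrite adjPl nA -adjP.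
by rewrite (adjPl A x x) -(adjP A x x); ring.
Qed.

(** Approximate eigenvectors obstruct the surjectivity of
    [(x, y) |-> (A - s) y - (B - p) x]: its values are small on them, whereas some
    vector is not. *)
Lemma joint_spectrum_approx A B (s p : R[i]) (w : nat -> K) :
  normal_op A -> normal_op B -> (forall n, rnorm (w n) = 1) ->
  (forall n, rnorm (A (w n) - s *: w n) <= 2 * (hump_scale R n / n.+1%:R)) ->
  (forall n, rnorm (B (w n) - p *: w n) <= 2 * (hump_scale R n / n.+1%:R)) ->
  joint_spectrum A B (s, p).
Proof.
move=> nA nB w1 hA hB /= [_ _ surj].
have [z zP] := gliding_hump w1; have [x [y zE]] := surj z.
have move1 (C : {bounded K -> K}) (c : R[i]) u v : '[C u - c *: u, v] = '[u, adj C v - c^* *: v].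
  by rewrite !inner_expand conjCK adjP.
pose c := 2 * (rnorm y + rnorm x).
have c0 : 0 <= c by rewrite mulr_ge0// addr_ge0// rnorm_ge0.
have bound n : cmod '[z, w n] <= c * (hump_scale R n / n.+1%:R).
  rewrite zE innerBl !move1; apply: (le_trans (cmodD _ _)); rewrite cmodN.
  apply: (le_trans (lerD (ler_cmod_inner _ _) (ler_cmod_inner _ _))).
  rewrite !normal_dist// /c mulrDr mulrDl lerD//.
    by apply: (le_trans (ler_wpM2l (rnorm_ge0 _) (hA n))); rewrite mulrCA mulrA.
  by apply: (le_trans (ler_wpM2l (rnorm_ge0 _) (hB n))); rewrite mulrCA mulrA.
pose N := Num.truncn (2 * c); have Nc : 2 * c < N.+1%:R by exact: truncnS_gt.
have := le_trans (zP N) (bound N); have := hump_scale_gt0 R N.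
have N0 : 0 < N.+1%:R :> R by rewrite ltr0n.
rewrite mulrA ler_pdivlMr// => a0 h.
have : hump_scale R N * (2^-1 * N.+1%:R) <= hump_scale R N * c by lra.
rewrite ler_pM2l//; lra.
Qed.

(** For unitary [U] this replaces Fuglede's theorem. *)
Lemma unitary_commuting_adj T U : unitary_op U -> commuting_ops T U ->
  commuting_ops T (adjb U).
Proof. by move=> [U1 U2] TU x; rewrite -!adjbE -[in RHS](U2 x) TU U1. Qed.

Lemma adj_commuting A B : commuting_ops A B -> commuting_ops (adjb A) (adjb B).
Proof. by move=> AB x; apply: inner_extr => y; rewrite -!adjbE -!adjP AB. Qed.

(** On [bGamma] one has [s = conj s * p].  A nonzero [T - T^* U] would be bounded
    below on some hyperinvariant subspace, hence on joint approximate eigenvectors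
    of [(T, U)]; but these belong to a point of the joint spectrum, and there
    [T - T^* U] is close to [s - conj s * p = 0]. *)
Lemma gamma_unitary_adj T U : gamma_unitary T U -> unitary_op U ->
  forall x, T x = adj T (U x).
Proof.
move=> [TU nT nU sp] uU.
pose Td := adjb T; pose Ud := adjb U.
have TUd : commuting_ops T Ud := unitary_commuting_adj uU TU.
have TdUd : commuting_ops Td Ud := adj_commuting TU.
have UTd : commuting_ops U Td.
  by move=> x; have := adj_commuting TUd x; rewrite /Ud -!adjbE !adjK.
have TTd : commuting_ops T Td by [].
have UUd : commuting_ops U Ud by [].
pose G := [set A : {bounded K -> K} | A = T \/ A = U \/ A = Td \/ A = Ud]%classic.
have GC A B : G A -> G B -> commuting_ops A B.
  have sym A1 B1 : commuting_ops A1 B1 -> commuting_ops B1 A1 by move=> h x; rewrite h.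
  by move=> [->|[->|[->|->]]] [->|[->|[->|->]]] //; apply: sym.
have bT : bicommutant G T by apply: bicommutant_sub; left.
have bU : bicommutant G U by apply: bicommutant_sub; right; left.
have bTd : bicommutant G Td by apply: bicommutant_sub; do 2!right; left.
have bUd : bicommutant G Ud by apply: bicommutant_sub; do 3!right.
pose N := comb_op 1 T (-1) (comp_op Td U).
pose Nd := comb_op 1 Td (-1) (comp_op Ud T).
have NE x : N x = T x - adj T (U x) by rewrite comb_opE scale1r scaleN1r.
have NdE x : Nd x = adj T x - adj U (T x) by rewrite comb_opE scale1r scaleN1r.
have NdP x y : '[N x, y] = '[x, Nd y].
  by rewrite NE NdE !inner_expand adjP adjPl adjP.
have bN : bicommutant G (comp_op Nd N).
  by apply: bicommutant_comp; apply: bicommutant_comb => //; apply: bicommutant_comp.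
have sN : selfadjoint (comp_op Nd N).
  by move=> x y; rewrite !comp_opE -NdP innerC -NdP -innerC.
move=> x0; apply/eqP; rewrite -subr_eq0 -NE; apply/eqP; apply: contrapT => Nx0.
have x00 : x0 <> 0 by move=> x00; apply: Nx0; rewrite x00 bounded0.
(* Half the Rayleigh quotient of [N^* N] at [x0], so that the cut is nontrivial. *)
pose t := rnorm (N x0) ^+ 2 / rnorm x0 ^+ 2 / 2.
have n0 := rnorm_gt0 Nx0; have m0 := rnorm_gt0 x00.
have t0 : 0 < t by rewrite !divr_gt0 ?exprn_gt0.
have NRe x : Re '[comp_op Nd N x, x] = rnorm (N x) ^+ 2.
  by rewrite comp_opE innerC -NdP Re_conjC ReinnerE.
have [||M [hM _ Mn low]] := hyperinvariant_cut GC (A := comp_op Nd N) (M := setT)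
    (t := t) (y := x0) sN bN _ Logic.I.
- by split.
- rewrite NRe /t mulrAC divfK ?gt_eqF ?exprn_gt0//.
  have : 0 < rnorm (N x0) ^+ 2 by rewrite exprn_gt0.
  lra.
(* The real and imaginary parts of [T] and [U]; here [hi = 1 / (2 i)]. *)
pose h : R[i] := (2^-1)%:C; pose hi : R[i] := - 'i%C * h.
have iN : ('i%C : R[i])^* = - 'i%C by apply/eqP; rewrite eq_complex /= oppr0 !eqxx.
have hiN : hi^* = - hi by rewrite /hi rmorphM rmorphN /= iN conj_real; ring.
pose A k := match k with
  | 0%N => comb_op h T h Td | 1%N => comb_op hi T (- hi) Td
  | 2 => comb_op h U h Ud | _ => comb_op hi U (- hi) Ud end.
have sA k : selfadjoint (A k).
  move: k => [|[|[|k]]] x y; rewrite !comb_opE !inner_expand ?rmorphN /= ?hiN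
    ?conj_real -?adjbE ?adjP ?adjPl; ring.
have bA k : bicommutant G (A k).
  by move: k => [|[|[|k]]]; apply: bicommutant_comb.
pose d n := hump_scale R n / n.+1%:R.
have d0 n : 0 < d n by rewrite divr_gt0 ?hump_scale_gt0 ?ltr0n.
have dle n p : (n <= p)%N -> d p <= d n.
  move=> np; rewrite /d ler_pM ?invr_ge0 ?ler0n ?(ltW (hump_scale_gt0 _ _))//.
    by rewrite /hump_scale ler_wiXn2l// ?invr_ge0// invf_le1// ler1n.
  by rewrite lef_pV2 ?posrE ?ltr0n// ler_nat.
have [|m [w wP]] := joint_approximate_eigenvalue GC 4 (M := M) d0 dle sA bA.
  by split.
have w1 n : rnorm (w n) = 1 by have [] := wP n.
have i1 : cmod ('i%C : R[i]) = 1 by rewrite /cmod normc_def /= expr0n expr1n add0r sqrtr1.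
have hh : h + h = 1 by rewrite /h -rmorphD -[RHS](rmorph1 (real_complex R)); congr (_%:C); lra.
have ihi : 'i%C * hi = h by rewrite /hi mulrA mulrN -expr2 sqr_i opprK mul1r.
pose s := (m 0%N)%:C + 'i%C * (m 1%N)%:C; pose p := (m 2)%:C + 'i%C * (m 3)%:C.
have part X Xd a b n : rnorm (comb_op h X h Xd (w n) - a%:C *: w n) <= d n ->
    rnorm (comb_op hi X (- hi) Xd (w n) - b%:C *: w n) <= d n ->
    rnorm (X (w n) - (a%:C + 'i%C * b%:C) *: w n) <= 2 * d n.
  rewrite !comb_opE => h1 h2.
  have -> : X (w n) - (a%:C + 'i%C * b%:C) *: w n =
      (h *: X (w n) + h *: Xd (w n) - a%:C *: w n) +
      'i%C *: (hi *: X (w n) + - hi *: Xd (w n) - b%:C *: w n).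
    rewrite !(scalerDr, scalerN) !scalerA mulrN ihi scalerDl opprD.
    rewrite -{1}[X (w n)]scale1r -{1}hh scalerDl scaleNr.
    move: (h *: X _) (h *: Xd _) (_ *: w n) (_ *: w n) => u v e f.
    by rewrite [RHS]addrACA [u + v + _]addrACA subrr addr0.
  apply: (le_trans (ler_rnormD _ _)); rewrite rnormZc i1 mul1r; lra.
have hT n : rnorm (T (w n) - s *: w n) <= 2 * d n.
  by have [_ _ wn] := wP n; apply: (part T Td); [exact: (wn 0%N)|exact: (wn 1%N)].
have hU n : rnorm (U (w n) - p *: w n) <= 2 * d n.
  by have [_ _ wn] := wP n; apply: (part U Ud); [exact: (wn 2)|exact: (wn 3)].
have [[z1 z2] /= [z11 z21] [sE pE]] := sp _ (joint_spectrum_approx nT nU w1 hT hU).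
have sp0 : s = s^* * p.
  have e1 : z1 * z1^* = 1 by rewrite -normCK z11 expr1n.
  have e2 : z2 * z2^* = 1 by rewrite -normCK z21 expr1n.
  rewrite -sE -pE rmorphD /= mulrDl.
  rewrite (_ : z1^* * (z1 * z2) = z1 * z1^* * z2); last by ring.
  rewrite (_ : z2^* * (z1 * z2) = z2 * z2^* * z1); last by ring.
  by rewrite e1 e2; ring.
have [c c0 Tc] := bounded_bound (adjb T).
have Nw n : rnorm (N (w n)) <= (2 + 2 * c + 2 * cmod p) * d n.
  have -> : N (w n) = (T (w n) - s *: w n) - adjb T (U (w n) - p *: w n)
      - p *: (adj T (w n) - s^* *: w n).
    rewrite NE boundedB boundedZ -adjbE scalerBr scalerA (mulrC p) -sp0.
    by rewrite !opprB addrAC [_ + (s *: _ - _)]addrA subrK addrA subrK.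
  apply: (le_trans (ler_rnormB _ _)); rewrite rnormZc normal_dist//.
  have h1 := ler_rnormB (T (w n) - s *: w n) (adjb T (U (w n) - p *: w n)).
  have h2 := Tc (U (w n) - p *: w n); have h3 := hT n.
  have h4 := ler_wpM2l c0 (hU n); have h5 := ler_wpM2l (cmod_ge0 p) h3.
  move: h1 h2 h3 h4 h5; move: (rnorm _) (rnorm _) (rnorm _) (rnorm _) (d n).
  by clear => *; lra.
have low1 n : t <= rnorm (N (w n)) ^+ 2.
  by have [Mw _ _] := wP n; have := low _ Mw; rewrite w1 expr1n mulr1 NRe.
pose C := 2 + 2 * c + 2 * cmod p.
have C0 : 0 < C by have := cmod_ge0 p; rewrite /C; lra.
have t1 : 0 < Num.sqrt t / C by rewrite divr_gt0// sqrtr_gt0.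
have [n hn] := hump_scale_small t1.
have dn : d n <= hump_scale R n.
  by rewrite ler_pdivrMr ?ltr0n// ler_peMr ?(ltW (hump_scale_gt0 _ _))// ler1n.
have := low1 n; rewrite leNgt => /negP; apply.
have : rnorm (N (w n)) < Num.sqrt t.
  apply: (le_lt_trans (Nw n)); rewrite -/C mulrC -ltr_pdivlMr//.
  exact: le_lt_trans hn.
by rewrite -(ltr_pXn2r (n:=2)) ?nnegrE ?rnorm_ge0 ?sqrtr_ge0// sqr_sqrtr// ltW.
Qed.

End gamma_unitaries.

(** * Isometries and unitary equivalence of total families *)

Section isometries.
Variable R : realType.

Lemma Re_inner_i (V : hilbertType R) (x y : V) : Re '[x, 'i%C *: y] = Im '[x, y].
Proof. by rewrite innerZr; case: '[x, y] => a b /=; ring. Qed.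

Lemma isometry_inner (V W : hilbertType R) (A : {bounded V -> W}) :
  (forall x, rnorm (A x) = rnorm x) -> forall x y, '[A x, A y] = '[x, y].
Proof.
move=> iA; have ReA x y : Re '[A x, A y] = Re '[x, y].
  have := rnorm_sqrD x y; have := rnorm_sqrD (A x) (A y).
  rewrite -boundedD !iA; lra.
move=> x y; apply/eqP; rewrite eq_complex ReA eqxx /= -!Re_inner_i.
by rewrite -(boundedZ A) ReA.
Qed.

Lemma isometry_adjK (V W : hilbertType R) (A : {bounded V -> W}) :
  (forall x, rnorm (A x) = rnorm x) -> forall x, adj A (A x) = x.
Proof. by move=> iA x; apply: inner_ext => y; rewrite adjPl isometry_inner. Qed.

(** An isometry is unitary as soon as its range has no orthogonal vector. *)
Lemma isometry_unitary (V W : hilbertType R) (A : {bounded V -> W}) :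
  (forall x, rnorm (A x) = rnorm x) ->
  (forall y, (forall x, '[y, A x] = 0) -> y = 0) -> unitary_op A.
Proof.
move=> iA tA; have K := isometry_adjK iA; split=> // y.
apply/eqP; rewrite eq_sym -subr_eq0; apply/eqP/tA => x.
by rewrite innerBl isometry_inner// adjPl subrr.
Qed.

(** [orth_proj] picks an arbitrary foot of the perpendicular; for the range of an
    isometry [J] there is one, namely [J J^* y]. *)
Lemma orth_proj_isometry (V W : hilbertType R) (J : {bounded V -> W}) y k :
  (forall x, rnorm (J x) = rnorm x) -> '[orth_proj (range J) y, J k] = '[y, J k].
Proof.
move=> iJ; have [_] : range J (orth_proj (range J) y) /\
    forall z, range J z -> '[y - orth_proj (range J) y, z] = 0.
  rewrite /orth_proj; apply: (@xgetPex _ 0 [set x | range J x /\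
    forall z, range J z -> '[y - x, z] = 0]%classic).
  exists (J (adj J y)); split; first by exists (adj J y).
  by move=> _ [z _ <-]; rewrite innerBl isometry_inner// adjPl subrr.
move=> /(_ (J k)) h; by apply/eqP; rewrite eq_sym -subr_eq0 -innerBl h.
Qed.

Lemma unitary_inner (V : hilbertType R) (U : {bounded V -> V}) x y :
  unitary_op U -> '[U x, U y] = '[x, y].
Proof. by move=> [U1 _]; rewrite adjP U1. Qed.

Definition total_family (I : Type) (V : hilbertType R) (e : I -> V) :=
  forall x, (forall i, '[x, e i] = 0) -> x = 0.

Lemma total_eq (I : Type) (V : hilbertType R) (e : I -> V) (x y : V) :
  total_family e -> (forall i, '[x, e i] = '[y, e i]) -> x = y.
Proof.
by move=> te h; apply/eqP; rewrite -subr_eq0; apply/eqP/te => i; rewrite innerBl h subrr.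
Qed.

Lemma total_bounded_eq (I : Type) (V W : hilbertType R) (e : I -> V)
    (A B : {bounded V -> W}) :
  total_family e -> (forall i, A (e i) = B (e i)) -> A =1 B.
Proof.
move=> te AB x; apply: inner_ext => y; rewrite !adjP; congr '[_, _].
by apply: (total_eq te) => i; rewrite !adjPl AB.
Qed.

Lemma closed_span_total (V : hilbertType R) (A : set V) (x : V) :
  closed_span A = setT -> (forall y, A y -> '[x, y] = 0) -> x = 0.
Proof.
move=> At xA.
have span y : smallest (@subspace_set R V) A y -> '[x, y] = 0.
  apply: (@smallest_sub _ (@subspace_set R V) A [set y | '[x, y] = 0]%classic) => //.
  split; first by rewrite /= inner0r.
  by move=> a u v /= hu hv; rewrite innerDr innerZr hu hv mulr0 addr0.
apply: rnorm_eq0; apply/eqP; rewrite -sqrf_eq0 eq_le exprn_ge0 ?rnorm_ge0// andbT.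
apply/ler_addgt0Pr => e e0; rewrite add0r.
have : closed_span A x by rewrite At.
have x1 : 0 < rnorm x + 1 by have := rnorm_ge0 x; lra.
move/closure_normP => /(_ _ (divr_gt0 e0 x1))[y /span xy].
rewrite ltr_pdivlMr// => h.
rewrite -ReinnerE (_ : '[x, x] = '[x, x - y]); last by rewrite innerBr xy subr0.
apply: (le_trans (ler_Re_cmod _)); apply: (le_trans (ler_cmod_inner _ _)).
apply: le_trans (ltW h); rewrite mulrC ler_wpM2l ?rnorm_ge0//; lra.
Qed.

(** The graph of the unitary [W] with [W (e i) = f i] is the closed subspace
    [M = {(x, y) | <x, e i> = <y, f i> for all i}] of the orthogonal sum.  The
    reflection [(x, y) |-> (x, -y)] exchanges [M] and its orthogonal complement:
    hence [M] is isometric over both factors, and projecting [(2 x, 0)] onto [M]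
    yields a point of [M] above [x]. *)
Section graph.
Variables (I : Type) (V W : hilbertType R) (e : I -> V) (f : I -> W).
Hypothesis te : total_family e.
Hypothesis tf : total_family f.
Hypothesis ef : forall i j, '[e i, e j] = '[f i, f j].

Let M : set (hsum V W) := [set z | forall i, '[z.1, e i] = '[z.2, f i]]%classic.
Let refl (z : hsum V W) : hsum V W := (z.1, - z.2).

Let M_sub : subspace_set M.
Proof.
split=> [|a x y Mx My] i; first by rewrite !inner0l.
by rewrite /= !inner_expand Mx My.
Qed.

Let M_orth z : (forall m, M m -> '[z, m] = 0) -> M (refl z).
Proof.
move=> zM i; have : M (e i, f i) by move=> j /=; exact: ef.
by move/zM; rewrite hsum_innerE /= innerNl => /eqP; rewrite addr_eq0 => /eqP.
Qed.

Let M_proj z : exists2 m, M m & forall m', M m' -> '[z - m, m'] = 0.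
Proof.
apply: projection_theorem => // x h i; apply/eqP; rewrite -subr_eq0; apply/eqP/cmod_eq0.
apply/eqP; rewrite eq_le cmod_ge0 andbT; apply/ler_addgt0Pr => d d0; rewrite add0r.
pose c := rnorm (e i) + rnorm (f i) + 1.
have c0 : 0 < c by rewrite ltr_wpDl// addr_ge0 ?rnorm_ge0.
have [y My xy] := h _ (divr_gt0 d0 c0).
have sq : rnorm (x - y) ^+ 2 = rnorm (x.1 - y.1) ^+ 2 + rnorm (x.2 - y.2) ^+ 2.
  by rewrite -!ReinnerE hsum_innerE raddfD.
have n1 : rnorm (x.1 - y.1) <= rnorm (x - y).
  by rewrite -ler_sqr_rnorm ?rnorm_ge0// sq lerDl exprn_ge0 ?rnorm_ge0.
have n2 : rnorm (x.2 - y.2) <= rnorm (x - y).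
  by rewrite -ler_sqr_rnorm ?rnorm_ge0// sq lerDr exprn_ge0 ?rnorm_ge0.
have -> : '[x.1, e i] - '[x.2, f i] = '[x.1 - y.1, e i] - '[x.2 - y.2, f i].
  by rewrite !innerBl (My i); ring.
apply: (le_trans (cmodD _ _)); rewrite cmodN.
apply: (le_trans (lerD (ler_cmod_inner _ _) (ler_cmod_inner _ _))).
move: xy; rewrite ltr_pdivlMr// => /ltW; apply: le_trans.
rewrite /c !mulrDr mulr1 -[leLHS]addr0 !lerD ?rnorm_ge0// ler_wpM2r ?rnorm_ge0//.
Qed.

Let M_refl m : M m -> '[m.1, m.1] = '[m.2, m.2].
Proof.
move=> Mm; have [p Mp ph] := M_proj (refl m).
have Mq := M_orth ph.
have Mrp : M (refl p).
  have -> : refl p = (-1) *: refl (refl m - p) + m.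
    rewrite /refl; case: p {Mp ph Mq} => p1 p2; case: m {Mm} => m1 m2 /=.
    by congr (_, _); rewrite /= scaleN1r; [rewrite opprB subrK|rewrite opprK addrAC addNr add0r].
  by case: M_sub => _; apply.
have p1 : p.1 = 0.
  apply: te => i; have e2 : '[p.1, e i] = - '[p.2, f i] by rewrite -innerNl; exact: Mrp.
  have /eqP : '[p.1, e i] *+ 2 = 0 by rewrite mulr2n {1}e2 (Mp i) addNr.
  by rewrite mulrn_eq0 /= => /eqP.
have p2 : p.2 = 0.
  apply: tf => i; by rewrite -(Mp i) p1 inner0l.
have := ph _ Mm; rewrite hsum_innerE /= p1 p2 !subr0 innerNl => /eqP.
by rewrite subr_eq0 => /eqP.
Qed.

Let M_above x : exists y, M (x, y).
Proof.
have [m Mm mh] := M_proj (2%:R *: x, 0); exists m.2.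
move=> i /=; have e1 := Mm i; have := M_orth mh i.
rewrite /= sub0r opprK -e1 => e2; apply: (@mulfI _ 2%:R); first by rewrite pnatr_eq0.
have : '[2%:R *: x, e i] = 2%:R * '[m.1, e i].
  by rewrite -[LHS](subrK '[m.1, e i]) -innerBl e2; ring.
by rewrite innerZl e1.
Qed.

Lemma unitary_extension : exists A : {bounded V -> W},
  unitary_op A /\ forall i, A (e i) = f i.
Proof.
have [A AM] := choice M_above.
have uniq x y : M (x, y) -> y = A x.
  by move=> h; apply: (total_eq tf) => i; rewrite -(h i) -(AM x i).
have lA : linear A.
  by move=> a x y; apply/esym/uniq; apply: (M_sub.2 a (x, _) (y, _)).
have iA x : rnorm (A x) = rnorm x by apply/esym/rnorm_inner; exact: (M_refl (AM x)).
have bA : exists c : R, forall x, rnorm (A x) <= c * rnorm x.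
  by exists 1 => x; rewrite mul1r iA.
have Ae i : A (e i) = f i by apply/esym/uniq => j /=; exact: ef.
exists (mk_bounded lA bA); split=> //; apply: isometry_unitary => // y h.
by apply: tf => i; rewrite -Ae.
Qed.

End graph.
End isometries.

(** * Moments of dilations *)

Section int_powers.
Variables (R : realType) (K : hilbertType R) (U : {bounded K -> K}).
Hypothesis uU : unitary_op U.

Lemma int_power_succ n x : int_power U (n + 1) x = U (int_power U n x).
Proof.
case: uU => U1 U2; case: n => [n|[|n]].
- by rewrite addrC -intS.
- by rewrite /= U2.
- by rewrite (_ : Negz n.+1 + 1 = Negz n) /= ?U2// !NegzE [n.+2%:Z]intS opprD addrAC addNr add0r.
Qed.

Lemma int_power_pred n x : int_power U (n - 1) x = adj U (int_power U n x).
Proof. by case: uU => U1 _; rewrite -[in RHS](subrK 1 n) int_power_succ U1. Qed.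

Lemma int_power_inner n m x y :
  '[int_power U n x, int_power U m y] = '[int_power U (n - m) x, y].
Proof.
elim/int_rec: m n => [|m IH|m IH] n; first by rewrite subr0.
  rewrite intS [1 + _]addrC int_power_succ -adjPl -int_power_pred IH.
  by congr '[int_power _ _ _, _]; ring.
have -> : - m.+1%:Z = - m%:Z - 1 by rewrite intS opprD addrC.
rewrite int_power_pred -adjP -int_power_succ IH.
by congr '[int_power _ _ _, _]; ring.
Qed.

Lemma iter_adj_inner n x y : '[iter n (adj U) x, y] = '[x, iter n U y].
Proof. by elim: n x => [|n IH] x //; rewrite iterSr IH adjPl. Qed.

Lemma iter_commute (T : {bounded K -> K}) n x : commuting_ops T U ->
  T (iter n U x) = iter n U (T x).
Proof. by move=> TU; elim: n => [|n IH] //=; rewrite TU IH. Qed.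

Lemma int_power_commute (T : {bounded K -> K}) n x : commuting_ops T U ->
  T (int_power U n x) = int_power U n (T x).
Proof.
move=> TU; have TV y : T (adj U y) = adj U (T y).
  by have := unitary_commuting_adj uU TU y.
case: n => n; first exact: iter_commute.
by rewrite /int_power; elim: n.+1 => //= k IH; rewrite TV IH.
Qed.

End int_powers.

Section models.
Variables (R : realType) (H : hilbertType R) (S P : {bounded H -> H}).

(** What a Gamma-unitary dilation of [(S, P)] has to satisfy for its restriction
    to the reducing subspace generated by [J H] to be determined by [(S, P)]. *)
Record dilation_model (K : hilbertType R) (J : H -> K) (T U : {bounded K -> K}) : Prop := {
  model_unitary : unitary_op U;
  model_commute : commuting_ops T U;
  model_U : forall n h k, '[iter n U (J h), J k] = '[iter n P h, k];
  model_T : forall n h k, '[iter n U (T (J h)), J k] = '[iter n P (S h), k];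
  model_adj : forall n h k, '[T (J h), iter n.+1 U (J k)] = '[h, S (iter n P k)] }.

Definition orbit_family (K : hilbertType R) (J : H -> K) (U : K -> K) (i : int * H) : K :=
  int_power U i.1 (J i.2).

(** The value of [<U ^ n J h, J k>] in every model. *)
Definition moment (n : int) h k : R[i] :=
  match n with Posz m => '[iter m P h, k] | Negz m => '[h, iter m.+1 P k] end.

(** The value of [<T U ^ n J h, J k>] in every model. *)
Definition twisted_moment (n : int) h k : R[i] :=
  match n with Posz m => '[iter m P (S h), k] | Negz m => '[h, S (iter m P k)] end.

Section one_model.
Variables (K : hilbertType R) (J : H -> K) (T U : {bounded K -> K}).
Hypothesis mK : dilation_model J T U.

Lemma orbit_moment i j :
  '[orbit_family J U i, orbit_family J U j] = moment (i.1 - j.1) i.2 j.2.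
Proof.
rewrite /orbit_family (int_power_inner (model_unitary mK)).
case: (i.1 - j.1) => n /=; first exact: (model_U mK).
by rewrite adjPl iter_adj_inner -iterSr innerC (model_U mK) -innerC.
Qed.

Lemma orbit_twisted_moment i j :
  '[T (orbit_family J U i), orbit_family J U j] = twisted_moment (i.1 - j.1) i.2 j.2.
Proof.
have uU := model_unitary mK.
rewrite /orbit_family (int_power_commute uU _ _ (model_commute mK)) (int_power_inner uU).
case: (i.1 - j.1) => n /=; first exact: (model_T mK).
by rewrite adjPl iter_adj_inner -iterSr (model_adj mK).
Qed.

End one_model.

(** The matrix of [T] in the total family [U ^ n J h] is the same in both models. *)
Lemma model_unique (K : hilbertType R) (J : H -> K) (T T' U : {bounded K -> K}) :
  dilation_model J T U -> dilation_model J T' U -> total_family (orbit_family J U) -> T' =1 T.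
Proof.
move=> m m' tU; apply: (total_bounded_eq tU) => i; apply: (total_eq tU) => j.
by rewrite (orbit_twisted_moment m) (orbit_twisted_moment m').
Qed.

(** Both families [U ^ n J h] have the same Gram matrix, which provides the unitary;
    it intertwines the operators because their matrices in these families agree. *)
Lemma model_equivalence (K K' : hilbertType R) (J : H -> K) (J' : H -> K')
    (T U : {bounded K -> K}) (T' U' : {bounded K' -> K'}) :
  dilation_model J T U -> dilation_model J' T' U' ->
  total_family (orbit_family J U) -> total_family (orbit_family J' U') ->
  unitarily_equivalent T' U' T U.
Proof.
move=> m m' tU tU'.
have [|W [uW We]] := unitary_extension tU' tU.
  by move=> i j; rewrite (orbit_moment m) (orbit_moment m').
have [W1 W2] := uW; have inW x y : '[W x, W y] = '[x, y] by rewrite adjP W1.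
have WT x : W (T' x) = T (W x).
  apply: (total_bounded_eq (A := comp_op W T') (B := comp_op T W) tU') => i.
  rewrite !comp_opE We; apply: (total_eq tU) => j; rewrite -{1}We inW.
  by rewrite (orbit_twisted_moment m) (orbit_twisted_moment m').
have WU x : W (U' x) = U (W x).
  apply: (total_bounded_eq (A := comp_op W U') (B := comp_op U W) tU') => -[n h].
  have step (L : hilbertType R) (I : H -> L) (A : {bounded L -> L}) : unitary_op A ->
      A (orbit_family I A (n, h)) = orbit_family I A (n + 1, h).
    by move=> uA; rewrite /orbit_family /= int_power_succ.
  by rewrite !comp_opE We (step _ _ _ (model_unitary m)) (step _ _ _ (model_unitary m')) We.
by exists W; split=> // x; rewrite WT WU !W2.
Qed.

(** With [T = T^* U], the moments against positive powers of [U] follow from the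
    dilation property as well. *)
Lemma dilation_is_model (K : hilbertType R) (J : {bounded H -> K}) (T U : {bounded K -> K}) :
  commuting_ops S P -> (forall h, rnorm (J h) = rnorm h) -> unitary_op U ->
  gamma_unitary_dilation J S P T U -> dilation_model J T U.
Proof.
move=> SP iJ uU [gTU dil]; have TU : commuting_ops T U by case: gTU.
have Tadj := gamma_unitary_adj gTU uU.
have mom m n h k : '[iter m T (iter n U (J h)), J k] = '[iter m S (iter n P h), k].
  by rewrite -(orth_proj_isometry _ _ iJ) -dil isometry_inner.
split=> // n h k; first exact: (mom 0%N n).
  by rewrite -(iter_commute _ _ TU) (mom 1%N n) /= (iter_commute _ _ SP).
rewrite Tadj adjPl (iter_commute _ _ TU) /= (unitary_inner _ _ uU).
by rewrite -(iter_commute _ _ TU) innerC (mom 1%N n) -innerC.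
Qed.

End models.

(** * Defect operators *)

Section closed_ranges.
Variables (R : realType) (V W : hilbertType R) (A : {bounded V -> W}).

Let clr : hilbertType R := closed_range A.

Lemma val_bound : exists c : R, forall x : clr, rnorm (val x) <= c * rnorm x.
Proof. by exists 1 => x; rewrite mul1r (@rnorm_inner R clr W x (val x)). Qed.

Definition val_op : {bounded clr -> W} :=
  mk_bounded ((fun a x y => erefl) : linear (val : clr -> W)) val_bound.

Lemma val_opE (x : clr) : val_op x = val x. Proof. by []. Qed.

Lemma to_closed_range_linear : linear (to_closed_range A : V -> clr).
Proof. by move=> a x y; apply: val_inj; rewrite /= boundedP. Qed.

Lemma to_closed_range_bound :
  exists c : R, forall x, rnorm (to_closed_range A x : clr) <= c * rnorm x.
Proof.
have [c _ Ac] := bounded_bound A; exists c => x; apply: le_trans (Ac x).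
by rewrite (@rnorm_inner R clr W (to_closed_range A x) (A x)).
Qed.

Definition to_closed_range_op : {bounded V -> clr} :=
  mk_bounded to_closed_range_linear to_closed_range_bound.

Lemma closed_range_total : total_family (to_closed_range A : V -> clr).
Proof.
move=> x h; apply: rnorm_eq0; apply/eqP.
rewrite -sqrf_eq0 eq_le exprn_ge0 ?rnorm_ge0// andbT.
apply/ler_addgt0Pr => e e0; rewrite add0r.
have x1 : 0 < rnorm x + 1 by rewrite ltr_wpDl ?rnorm_ge0.
have [v] := elimT (in_closed_rangeP A (val x)) (valP x) _ (divr_gt0 e0 x1).
rewrite (_ : rnorm (val x - A v) = rnorm (x - to_closed_range A v : clr)); last first.
  by apply: rnorm_inner.
rewrite ltr_pdivlMr// => hv.
rewrite -ReinnerE (_ : '[x, x] = '[x, x - to_closed_range A v]); last first.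
  by rewrite innerBr h subr0.
apply: (le_trans (ler_Re_cmod _)); apply: (le_trans (ler_cmod_inner _ _)).
by apply: le_trans (ltW hv); rewrite mulrC ler_wpM2l ?rnorm_ge0// lerDl.
Qed.

End closed_ranges.

(** The kernel of a self-adjoint operator is orthogonal to its range. *)
Lemma selfadjoint_range_inj (R : realType) (V : hilbertType R) (D : {bounded V -> V})
    (x y : closed_range D) : selfadjoint D -> D (val x) = D (val y) -> x = y.
Proof.
move=> sD h; apply: (total_eq (@closed_range_total _ _ _ D)) => v.
by rewrite !closed_range_innerE /= -!sD h.
Qed.

Section defects.
Variables (R : realType) (H : hilbertType R) (P : {bounded H -> H}).
Hypothesis cP : forall x, rnorm (P x) <= rnorm x.

Lemma adj_contraction x : rnorm (adj P x) <= rnorm x.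
Proof.
have [->|n0] := eqVneq (rnorm (adj P x)) 0; first exact: rnorm_ge0.
have n1 : 0 < rnorm (adj P x) by rewrite lt_def n0 rnorm_ge0.
rewrite -(ler_pM2l n1) -expr2 -ReinnerE -adjP (le_trans (ler_Re_cmod _))//.
by rewrite (le_trans (ler_cmod_inner _ _))// ler_wpM2r ?rnorm_ge0.
Qed.

Let X x := adj P (P x).
Let Z x := P (adj P x).

Let lX : linear X.
Proof. by move=> a x y; rewrite /X boundedP adjbE boundedP. Qed.
Let lZ : linear Z.
Proof. by move=> a x y; rewrite /Z adjbE !boundedP. Qed.
Let cX x : rnorm (X x) <= rnorm x.
Proof. by apply: le_trans (cP x); exact: adj_contraction. Qed.
Let cZ x : rnorm (Z x) <= rnorm x.
Proof. by apply: le_trans (adj_contraction x); exact: cP. Qed.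
Let sX : selfadjoint X.
Proof. by move=> x y; rewrite /X adjPl adjP. Qed.
Let sZ : selfadjoint Z.
Proof. by move=> x y; rewrite /Z adjP adjPl. Qed.

Lemma defect_selfadjoint : selfadjoint (defect P).
Proof. by have [/positive_selfadjoint] := sqrt_opP lX cX sX. Qed.

Lemma codefect_selfadjoint : selfadjoint (codefect P).
Proof. by have [/positive_selfadjoint] := sqrt_opP lZ cZ sZ. Qed.

Lemma defectK x : defect P (defect P x) = x - adj P (P x).
Proof. by have [_ ->] := sqrt_opP lX cX sX. Qed.

Lemma codefectK x : codefect P (codefect P x) = x - P (adj P x).
Proof. by have [_ ->] := sqrt_opP lZ cZ sZ. Qed.

(** [P] intertwines [1 - P^* P] and [1 - P P^*], and square roots inherit this. *)
Lemma codefect_intertwine x : P (defect P x) = codefect P (P x).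
Proof. exact: (sqrt_op_morph (B := P) lX cX sX lZ cZ sZ). Qed.

Lemma defect_intertwine x : adj P (codefect P x) = defect P (adj P x).
Proof. exact: (sqrt_op_morph (B := adjb P) lZ cZ sZ lX cX sX). Qed.

Lemma adj_codefect_range (b : codefect_space P) :
  adj P (val b) \in in_closed_range (defect P).
Proof.
apply/in_closed_rangeP => e e0.
have [v hv] := elimT (in_closed_rangeP _ _) (valP b) _ e0; exists (adj P v).
apply: le_lt_trans hv; rewrite -defect_intertwine adjbE -boundedB.
exact: adj_contraction.
Qed.

(** [P^*] as an operator between the defect spaces. *)
Definition adj_codefect (b : codefect_space P) : defect_space P :=
  ClosedRange (adj_codefect_range b).

Lemma adj_codefect_linear : linear adj_codefect.
Proof. by move=> a x y; apply: val_inj; rewrite /= adjbE boundedP. Qed.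

Lemma adj_codefect_bound :
  exists c : R, forall x, rnorm (adj_codefect x) <= c * rnorm x.
Proof.
exists 1 => x; rewrite mul1r (@rnorm_inner _ _ H (adj_codefect x) (adj P (val x)))//.
by apply: (le_trans (adj_contraction _)); rewrite (@rnorm_inner _ _ (codefect_space P) (val x) x).
Qed.

Definition adj_codefect_op : {bounded codefect_space P -> defect_space P} :=
  mk_bounded adj_codefect_linear adj_codefect_bound.

Lemma adj_codefectE b : val (adj_codefect_op b) = adj P (val b).
Proof. by []. Qed.

End defects.

(** * Identities for the fundamental operators *)

Section fundamental_identities.
Variables (R : realType) (H : hilbertType R) (S P : {bounded H -> H}).
Variables (F : {bounded defect_space P -> defect_space P}).
Variables (G : {bounded codefect_space P -> codefect_space P}).
Hypothesis cP : forall x, rnorm (P x) <= rnorm x.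
Hypothesis SP : commuting_ops S P.
Hypothesis fF : fundamental_op S F.
Hypothesis fG : cofundamental_op S G.

Local Notation D := (defect P).
Local Notation Dc := (codefect P).
Local Notation d := (to_closed_range (defect P)).
Local Notation dc := (to_closed_range (codefect P)).
Local Notation Q := (adj_codefect_op cP).

Let sD := defect_selfadjoint cP.
Let sDc := codefect_selfadjoint cP.

Lemma adj_commute x : adj S (adj P x) = adj P (adj S x).
Proof. by have := adj_commuting SP x. Qed.

(** The adjoint of the defining equation [S - S^* P = D F D]. *)
Lemma fundamental_adj h : D (val (adj F (d h))) = adj S h - adj P (S h).
Proof.
apply: inner_ext => k; rewrite sD.
rewrite (_ : '[val (adj F (d h)), D k] = '[adj F (d h), d k]) // adjPl.
rewrite closed_range_innerE /= sD -fF.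
by rewrite innerBr innerBl !adjPl adjP.
Qed.

Lemma cofundamental_adj h : Dc (val (adj G (dc h))) = S h - P (adj S h).
Proof.
apply: inner_ext => k; rewrite sDc.
rewrite (_ : '[val (adj G (dc h)), Dc k] = '[adj G (dc h), dc k]) // adjPl.
rewrite closed_range_innerE /= sDc -fG.
by rewrite innerBr innerBl !adjP adjPl.
Qed.

(** The next four identities reduce to computations with [S] and [P].  Two vectors of the closure of
    the range of [D] agree if [D] maps them to the same vector, and two operators
    on the closure of the range of [Dc] agree if they do on the vectors [Dc h].
    Then [F], [G] and their adjoints only occur in [D F D], [Dc G Dc] and the adjoints
    of these, which are expressions in [S] and [P]. *)
Lemma defect_commute h : d (S h) = F (d h) + adj F (d (P h)).
Proof.
apply: (selfadjoint_range_inj sD); rewrite /= boundedD -fF fundamental_adj defectK//.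
by rewrite -SP addrA subrK.
Qed.

Lemma F_adj_codefect b : adj F (Q b) = Q (G b).
Proof.
apply: (total_bounded_eq (A := comp_op (adjb F) Q) (B := comp_op Q G)
  (@closed_range_total _ _ _ Dc)) => h.
rewrite !comp_opE -adjbE (_ : Q (dc h) = d (adj P h)); last first.
  by apply: val_inj; rewrite /= defect_intertwine.
apply: (selfadjoint_range_inj sD).
rewrite fundamental_adj adj_codefectE -(defect_intertwine cP) -fG adj_commute.
by rewrite [in RHS]adjbE boundedB.
Qed.

Lemma S_codefect b : S (Dc (val b)) = P (Dc (val (G b))) + Dc (val (adj G b)).
Proof.
pose E := comp_op Dc (val_op Dc).
suff : comp_op S E =1 comb_op 1 (comp_op P (comp_op E G)) 1 (comp_op E (adjb G)).
  by move=> /(_ b); rewrite comb_opE !scale1r.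
apply: (total_bounded_eq (@closed_range_total _ _ _ Dc)) => h.
rewrite comb_opE !scale1r !comp_opE !val_opE /= -fG cofundamental_adj codefectK//.
by rewrite !boundedB SP [RHS]addrC addrA subrK.
Qed.

Lemma F_defect_codefect b :
  adj F (d (Dc (val b))) - F (Q b) = d (Dc (val (G b))) - Q (adj G b).
Proof.
pose E := comp_op (to_closed_range_op D) (comp_op Dc (val_op Dc)).
suff : comb_op 1 (comp_op (adjb F) E) (-1) (comp_op F Q) =1
    comb_op 1 (comp_op E G) (-1) (comp_op Q (adjb G)).
  by move=> /(_ b); rewrite !comb_opE !scale1r !scaleN1r.
apply: (total_bounded_eq (@closed_range_total _ _ _ Dc)) => h.
rewrite !comb_opE !scale1r !scaleN1r !comp_opE !val_opE.
rewrite (_ : Q (dc h) = d (adj P h)); last first.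
  by apply: val_inj; rewrite /= defect_intertwine.
apply: (selfadjoint_range_inj sD).
rewrite -[LHS]/(D (val (adj F (d (Dc (Dc h))) - F (d (adj P h))))).
rewrite -[RHS]/(D (val (d (Dc (val (G (dc h)))) - Q (adj G (dc h))))).
have vd y : val (d y) = D y by [].
have vB (x y : defect_space P) : val (x - y) = val x - val y by [].
rewrite !vB !boundedB fundamental_adj codefectK// -fF adj_codefectE vd -fG.
rewrite -(defect_intertwine cP) cofundamental_adj defectK//.
rewrite !adjbE !boundedB -!adjbE SP -[P (S _)]SP.
by apply: inner_ext => k; rewrite !innerBl; ring.
Qed.

End fundamental_identities.

(** * The Schaeffer dilation space *)

Section square_summable_sequences.
Variables (R : realType) (V : hilbertType R).
Implicit Types a c y : l2 V.

Let l2_normE a : rnorm a ^+ 2 = limn (series (fun k => rnorm (a k) ^+ 2)).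
Proof.
rewrite -ReinnerE l2_innerE /csum /=; congr (limn (series _)).
by apply/funext => k; rewrite ReinnerE.
Qed.

Lemma l2_norm_cons a c : (forall n, c n.+1 = a n) ->
  rnorm c ^+ 2 = rnorm (c 0%N) ^+ 2 + rnorm a ^+ 2.
Proof.
move=> ca; rewrite !l2_normE.
have cvga : cvgn (series (fun k => rnorm (a k) ^+ 2)) by exact/asboolP/(l2_valP a).
apply: cvg_lim => //; rewrite -cvg_shiftS.
rewrite (_ : (fun n => _) = fun n => rnorm (c 0%N) ^+ 2 + series (fun k => rnorm (a k) ^+ 2) n).
  by apply: cvgD => //; exact: cvg_cst.
apply/funext => n; rewrite /series /= big_nat_recl//; congr (_ + _).
by apply: eq_bigr => k _; rewrite ca.
Qed.

Lemma l2_inner_single a y m : (forall n, n != m -> a n = 0) -> '[y, a] = '[y m, a m].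
Proof.
move=> am; have single (f : R ^nat) : (forall n, n != m -> f n = 0) -> limn (series f) = f m.
  move=> f0; apply: lim_near_cst => //; exists m.+1 => // n /= mn.
  rewrite /series /= (bigD1_seq m) ?iota_uniq ?mem_index_iota//= big1 ?addr0//.
rewrite l2_innerE /csum !single => [|n nm|n nm]; last 2 first.
- by rewrite am// inner0r.
- by rewrite am// inner0r.
by case: '[_, _].
Qed.

Lemma l2_single_exists m (v : V) : exists2 a : l2 V, a m = v & forall n, n != m -> a n = 0.
Proof.
pose f n := if n == m then v else 0.
have fl2 : f \in @square_summable R V.
  apply/square_summableP; exists (rnorm v ^+ 2) => n.
  have [mn|nm] := ltnP m n.
    rewrite (bigD1_seq m) ?iota_uniq ?mem_index_iota//= /f eqxx big1 ?addr0// => i im.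
    by rewrite (negPf im) rnorm0 expr0n.
  rewrite big_nat_cond big1 ?exprn_ge0 ?rnorm_ge0// => i /andP[/andP[_ i_n] _].
  by rewrite /f ltn_eqF ?rnorm0 ?expr0n//; exact: leq_trans nm.
by exists (L2 fl2) => [|n nm] /=; rewrite /f ?eqxx// (negPf nm).
Qed.

End square_summable_sequences.

Section embedding.
Variables (R : realType) (H : hilbertType R) (P : {bounded H -> H}).

Lemma dilation_space_eq (x y : dilation_space P) : x.1 = y.1 ->
  (forall n, x.2.1 n = y.2.1 n) -> (forall n, x.2.2 n = y.2.2 n) -> x = y.
Proof.
case: x y => [h [a b]] [k [c e]] /= -> ac be; congr (_, (_, _)).
  by apply/val_inj/funext.
by apply/val_inj/funext.
Qed.

Lemma dilation_space_inner (x y : dilation_space P) :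
  '[x, y] = '[x.1, y.1] + ('[x.2.1, y.2.1] + '[x.2.2, y.2.2]).
Proof. by []. Qed.

Lemma dilation_space_norm (x : dilation_space P) :
  rnorm x ^+ 2 = rnorm x.1 ^+ 2 + rnorm x.2.1 ^+ 2 + rnorm x.2.2 ^+ 2.
Proof.
have add (z p q r : R[i]) (n a b c : R) : Re z = n -> Re p = a -> Re q = b -> Re r = c ->
    z = p + (q + r) -> n = a + b + c.
  by move=> <- <- <- <- ->; case: p q r => ? ? [? ?] [? ?] /=; rewrite addrA.
exact: (add _ _ _ _ _ _ _ _ (ReinnerE x) (ReinnerE x.1) (ReinnerE x.2.1)
  (ReinnerE x.2.2) (dilation_space_inner x x)).
Qed.

Lemma embed_inner (x : dilation_space P) h : '[x, embed P h] = '[x.1, h].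
Proof.
rewrite dilation_space_inner (_ : (embed P h).2.1 = 0) // (_ : (embed P h).2.2 = 0) //.
by rewrite !inner0r !addr0.
Qed.

Lemma embed_linear : linear (@embed R H P).
Proof. by move=> a x y; congr (_, (_, _)); rewrite /= ?scaler0 ?addr0. Qed.

Lemma embed_norm h : rnorm (embed P h) = rnorm h.
Proof. by apply: rnorm_inner; rewrite embed_inner. Qed.

Lemma embed_bound : exists c : R, forall h, rnorm (embed P h) <= c * rnorm h.
Proof. by exists 1 => h; rewrite embed_norm mul1r. Qed.

Definition embed_op : {bounded H -> dilation_space P} := mk_bounded embed_linear embed_bound.

End embedding.

Section schaeffer.
Variables (R : realType) (H : hilbertType R) (P : {bounded H -> H}).
Hypothesis cP : forall x, rnorm (P x) <= rnorm x.
Variable U : {bounded dilation_space P -> dilation_space P}.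
Hypothesis hU : is_dilation_U U.

Local Notation D := (defect P).
Local Notation Dc := (codefect P).
Local Notation K := (dilation_space P).
Let sD := defect_selfadjoint cP.
Let sDc := codefect_selfadjoint cP.

Lemma dilation_U_base (x : K) : (U x).1 = P x.1 + Dc (val (x.2.2 0%N)).
Proof. by case: x => h [a b]; case: (hU h a b). Qed.
Lemma dilation_U_first_val (x : K) : val ((U x).2.1 0%N) = D x.1 - adj P (val (x.2.2 0%N)).
Proof. by case: x => h [a b]; case: (hU h a b). Qed.
Lemma dilation_U_forward (x : K) n : (U x).2.1 n.+1 = x.2.1 n.
Proof. by case: x => h [a b]; case: (hU h a b). Qed.
Lemma dilation_U_backward (x : K) n : (U x).2.2 n = x.2.2 n.+1.
Proof. by case: x => h [a b]; case: (hU h a b). Qed.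

(** The Julia operator of a contraction is isometric. *)
Lemma julia_isometry h b :
  rnorm (P h + Dc b) ^+ 2 + rnorm (D h - adj P b) ^+ 2 = rnorm h ^+ 2 + rnorm b ^+ 2.
Proof.
rewrite rnorm_sqrD rnorm_sqrB.
have -> : '[P h, Dc b] = '[D h, adj P b] by rewrite adjP defect_intertwine// -sD.
have -> : rnorm (D h) ^+ 2 = rnorm h ^+ 2 - rnorm (P h) ^+ 2.
  by rewrite -!ReinnerE sD defectK// innerBr -adjP raddfB.
have -> : rnorm (Dc b) ^+ 2 = rnorm b ^+ 2 - rnorm (adj P b) ^+ 2.
  by rewrite -!ReinnerE sDc codefectK// innerBr -adjPl raddfB.
ring.
Qed.

Lemma dilation_U_isometry (x : K) : rnorm (U x) = rnorm x.
Proof.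
have e1 := l2_norm_cons (dilation_U_forward x).
have e2 := l2_norm_cons (fun n => esym (dilation_U_backward x n)).
have n0 : rnorm ((U x).2.1 0%N) = rnorm (D x.1 - adj P (val (x.2.2 0%N))).
  by rewrite -dilation_U_first_val; exact: (@rnorm_inner R (defect_space P) H).
have b0 : rnorm (x.2.2 0%N) = rnorm (val (x.2.2 0%N)).
  exact: (@rnorm_inner R (codefect_space P) H).
have s1 := dilation_space_norm (U x); have s2 := dilation_space_norm x.
have j := julia_isometry x.1 (val (x.2.2 0%N)).
rewrite dilation_U_base in s1; rewrite n0 in e1; rewrite b0 in e2.
have alg (X Y J1 J2 a b c e h bb : R) : X = J1 + c + e -> Y = h + a + b ->
    c = J2 + a -> b = bb + e -> J1 + J2 = h + bb -> X = Y by clear; lra.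
apply/eqP; rewrite -(eqrXn2 (n:=2)) ?rnorm_ge0//; apply/eqP.
exact: (alg _ _ _ _ _ _ _ _ _ _ s1 s2 e1 e2 j).
Qed.

(** Testing [y] against the images of [H] and of the sequences supported at one
    index recovers every coordinate of [y]. *)
Lemma dilation_U_range (y : K) : (forall x, '[y, U x] = 0) -> y = 0.
Proof.
set k := y.1; set c := y.2.1; set e := y.2.2 => h.
have inn (x : K) m n : (forall j, j != m -> (U x).2.1 j = 0) ->
    (forall j, j != n -> (U x).2.2 j = 0) ->
    '[k, (U x).1] + '[c m, (U x).2.1 m] + '[e n, (U x).2.2 n] = 0.
  by move=> h1 h2; rewrite -(h x) dilation_space_inner (l2_inner_single _ h1)
    (l2_inner_single _ h2) addrA.
have zero2 (x : K) : x.1 = 0 -> x.2.2 0%N = 0 -> (U x).2.1 0%N = 0.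
  by move=> x1 x2; apply: val_inj; rewrite dilation_U_first_val x1 x2 bounded0 adjbE bounded0 subrr.
have zero1 (x : K) : x.1 = 0 -> x.2.2 0%N = 0 -> (U x).1 = 0.
  by move=> x1 x2; rewrite dilation_U_base x1 x2 !bounded0 addr0.
have cS n : c n.+1 = 0.
  have [a an a0] := l2_single_exists n (c n.+1); pose x : K := (0, (a, 0)).
  have := inn x n.+1 0%N; rewrite zero1// dilation_U_forward dilation_U_backward /= an
    !inner0r add0r addr0.
  move=> z; apply: inner_eq0; apply: z => [[|j]|j] jn; first exact: zero2.
    by rewrite dilation_U_forward /= a0.
  by rewrite dilation_U_backward.
have eS n : e n = 0.
  have [b bn b0] := l2_single_exists n.+1 (e n); pose x : K := (0, (0, b)).
  have x0 : x.2.2 0%N = 0 by rewrite /= b0.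
  have := inn x 0%N n; rewrite zero1// zero2// dilation_U_backward /= bn !inner0r !add0r.
  move=> z; apply: inner_eq0; apply: z => [[|j]|j] jn //.
    by rewrite dilation_U_forward.
  by rewrite dilation_U_backward /= b0.
(* Testing against [U h], then against [U] of sequences supported at index [0],
   gives [P^* k = - D c_0] and [k - P P^* k = Dc P c_0]; these force [k = 0]. *)
have kc : adj P k = - D (val (c 0%N)).
  apply: inner_ext => g; pose x : K := (g, (0, 0)).
  have u1 : (U x).1 = P g by rewrite dilation_U_base [val _]/= bounded0 addr0.
  have u2 : '[c 0%N, (U x).2.1 0%N] = '[val (c 0%N), D g].
    rewrite closed_range_innerE dilation_U_first_val (_ : val (x.2.2 0%N) = 0)//.
    by rewrite adjbE bounded0 subr0.
  have z : '[k, (U x).1] + '[c 0%N, (U x).2.1 0%N] + '[e 0%N, (U x).2.2 0%N] = 0.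
    by apply: inn => [[|j]|j] jn //; rewrite ?dilation_U_forward ?dilation_U_backward.
  move: z; rewrite u1 u2 dilation_U_backward (_ : x.2.2 1%N = 0)// inner0r addr0 => z.
  rewrite innerNl adjPl sD; apply/eqP; rewrite -addr_eq0; exact/eqP.
have k0 : k = 0.
  have kk : Dc (Dc k) = Dc (P (val (c 0%N))).
    apply: inner_ext => g; have [b b0 bn] := l2_single_exists 0%N (to_closed_range Dc g).
    pose x : K := (0, (0, b)).
    have x0 : val (x.2.2 0%N) = Dc g by rewrite (_ : x.2.2 0%N = to_closed_range Dc g).
    have u1 : (U x).1 = Dc (Dc g) by rewrite dilation_U_base x0 (_ : x.1 = 0)// bounded0 add0r.
    have u2 : '[c 0%N, (U x).2.1 0%N] = - '[Dc (P (val (c 0%N))), g].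
      rewrite closed_range_innerE dilation_U_first_val x0 (_ : x.1 = 0)// bounded0 sub0r.
      by rewrite innerNr sDc adjP.
    have z : '[k, (U x).1] + '[c 0%N, (U x).2.1 0%N] + '[e 0%N, (U x).2.2 0%N] = 0.
      apply: inn => [[|j]|j] jn //; first by rewrite dilation_U_forward.
      by rewrite dilation_U_backward (_ : x.2.2 j.+1 = b j.+1)// bn.
    move: z; rewrite u1 u2 dilation_U_backward (_ : x.2.2 1%N = b 1%N)// bn// inner0r addr0 => z.
    have -> : '[Dc (Dc k), g] = '[k, Dc (Dc g)] by rewrite !sDc.
    exact: subr0_eq.
  have := kk; rewrite codefectK// -codefect_intertwine// -[D _]opprK -kc boundedN.
  by move/eqP; rewrite -subr_eq0 opprK subrK => /eqP.
have c0 : c 0%N = 0.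
  apply: (selfadjoint_range_inj sD); rewrite [RHS]bounded0.
  by apply: oppr_inj; rewrite -kc k0 adjbE bounded0 oppr0.
by apply: dilation_space_eq => //= -[|n].
Qed.

Lemma dilation_U_unitary : unitary_op U.
Proof. exact: isometry_unitary dilation_U_isometry dilation_U_range. Qed.

(** The orthogonal complement [N] of the orbit of [H] reduces [U] and consists of
    vectors without component in [H].  For [x] in [N] the first coordinate of
    [U x] is [D_{P*} b_0], so [b_0 = 0]; following [x] along [U] kills all [b_n],
    and following it along [U^*] kills all [a_n]. *)
Lemma dilation_U_minimal : total_family (orbit_family (@embed R H P) U).
Proof.
move=> x0 hx0; have uU := dilation_U_unitary; have [U1 U2] := uU.
pose N : set K := [set x | forall i, '[x, orbit_family (@embed R H P) U i] = 0]%classic.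
have NU x : N x -> N (U x).
  by move=> Nx [n h]; rewrite adjP -int_power_pred//; exact: (Nx (n - 1, h)).
have NV x : N x -> N (adj U x).
  by move=> Nx [n h]; rewrite adjPl -int_power_succ//; exact: (Nx (n + 1, h)).
have N1 x : N x -> x.1 = 0.
  by move=> Nx; apply: inner_ext => h; rewrite inner0l -embed_inner; exact: (Nx (0, h)).
have Nb n x : N x -> x.2.2 n = 0.
  elim: n x => [|n IH] x Nx; last by rewrite -dilation_U_backward; apply: IH; exact: NU.
  apply: (selfadjoint_range_inj sDc); rewrite [RHS]bounded0.
  by have := N1 _ (NU _ Nx); rewrite dilation_U_base (N1 _ Nx) bounded0 add0r.
have Na n x : N x -> x.2.1 n = 0.
  elim: n x => [|n IH] x Nx; rewrite -(U2 x); last first.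
    by rewrite dilation_U_forward; apply: IH; exact: NV.
  apply: val_inj; rewrite dilation_U_first_val (N1 _ (NV _ Nx)) (Nb 0%N _ (NV _ Nx)).
  by rewrite adjbE !bounded0 subrr.
apply: dilation_space_eq => [|n|n]; [exact: N1|exact: Na|exact: Nb].
Qed.

Lemma iter_dilation_U n (x : K) : x.2.2 = 0 ->
  (iter n U x).1 = iter n P x.1 /\ (iter n U x).2.2 = 0.
Proof.
move=> x2; elim: n => [|n [IH1 IH2]] //=; rewrite dilation_U_base IH1 IH2 bounded0 addr0.
by split=> //; apply/val_inj/funext => m; rewrite /= dilation_U_backward IH2.
Qed.

Variables S : {bounded H -> H}.
Variables (F : {bounded defect_space P -> defect_space P}).
Variables (G : {bounded codefect_space P -> codefect_space P}).
Variable T : {bounded K -> K}.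
Hypothesis SP : commuting_ops S P.
Hypothesis fF : fundamental_op S F.
Hypothesis fG : cofundamental_op S G.
Hypothesis hT : is_dilation_R S F G T.

Local Notation d := (to_closed_range (defect P)).
Local Notation Q := (adj_codefect_op cP).

Lemma dilation_T_base (x : K) : (T x).1 = S x.1 + Dc (val (G (x.2.2 0%N))).
Proof. by case: x => h [a b]; case: (hT h a b). Qed.
Lemma dilation_T_first (x : K) :
  (T x).2.1 0%N = adj F (d x.1) + F (x.2.1 0%N) - Q (G (x.2.2 0%N)).
Proof. by case: x => h [a b]; apply: val_inj; case: (hT h a b). Qed.
Lemma dilation_T_forward (x : K) n : (T x).2.1 n.+1 = adj F (x.2.1 n) + F (x.2.1 n.+1).
Proof. by case: x => h [a b]; case: (hT h a b). Qed.
Lemma dilation_T_backward (x : K) n : (T x).2.2 n = adj G (x.2.2 n) + G (x.2.2 n.+1).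
Proof. by case: x => h [a b]; case: (hT h a b). Qed.

Lemma dilation_U_first (x : K) : (U x).2.1 0%N = d x.1 - Q (x.2.2 0%N).
Proof. by apply: val_inj; rewrite dilation_U_first_val. Qed.

Let dD x y : d (x + y) = d x + d y.
Proof. exact: (boundedD (to_closed_range_op D)). Qed.

(** Coordinate by coordinate, [T U = U T] amounts to the four identities for the
    fundamental operators. *)
Lemma dilation_commute : commuting_ops T U.
Proof.
move=> x; set b0 := x.2.2 0%N; set b1 := x.2.2 1%N.
apply: dilation_space_eq => [|[|[|n]]|n].
- rewrite dilation_T_base !dilation_U_base dilation_T_base dilation_T_backward
    dilation_U_backward -/b0 -/b1.
  rewrite !boundedD SP (S_codefect cP SP fG) -!addrA; congr (_ + _).
- rewrite dilation_T_first !dilation_U_first dilation_U_base dilation_U_backward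
    dilation_T_base dilation_T_backward -/b0 -/b1.
  rewrite !dD (defect_commute cP SP fF) !adjbE !boundedD boundedN -!adjbE.
  have e := F_defect_codefect cP SP fF fG b0.
  have -> : adj F (d (Dc (val b0))) = d (Dc (val (G b0))) - Q (adj G b0) + F (Q b0).
    by rewrite -e subrK.
  apply: inner_ext => k; rewrite !(innerDl, innerBl, innerNl); ring.
- rewrite dilation_T_forward dilation_U_first !dilation_U_forward dilation_T_first -/b0.
  rewrite adjbE boundedB -!adjbE (F_adj_codefect cP SP fF fG) addrAC.
  by apply: inner_ext => k; rewrite !(innerDl, innerBl, innerNl); ring.
- by rewrite dilation_T_forward !dilation_U_forward dilation_T_forward.
- by rewrite dilation_T_backward !dilation_U_backward dilation_T_backward.
Qed.

(** In the moments of [T] against positive powers of [U], the orbit of [embed k]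
    only meets the component in [H] and the first defect coordinate of
    [T (embed h)]; the equation for [F] adds the two contributions up to [S P ^ n]. *)
Lemma schaeffer_model : dilation_model S P (@embed R H P) T U.
Proof.
have T1 h : (T (embed P h)).1 = S h by rewrite dilation_T_base /= !bounded0 addr0.
have T2 h : (T (embed P h)).2.2 = 0.
  by apply/val_inj/funext => n; rewrite /= dilation_T_backward /= adjbE !bounded0 addr0.
split=> [||n h k|n h k|n h k]; first exact: dilation_U_unitary.
- exact: dilation_commute.
- by rewrite embed_inner; have [-> _] := iter_dilation_U n (erefl : (embed P h).2.2 = 0).
- by rewrite embed_inner; have [-> _] := iter_dilation_U n (T2 h); rewrite T1.
set w := iter n P k; set y := iter n.+1 U (embed P k).
have [U1 U2] := iter_dilation_U n (erefl : (embed P k).2.2 = 0).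
have y1 : y.1 = P w by have [] := iter_dilation_U n.+1 (erefl : (embed P k).2.2 = 0).
have y2 : y.2.1 0%N = d w by rewrite /y iterS dilation_U_first U1 U2 (_ : Q _ = 0) ?subr0 ?bounded0.
have t2 : (T (embed P h)).2.1 0%N = adj F (d h) by rewrite dilation_T_first !bounded0 addr0 subr0.
have e1 : '[(T (embed P h)).2.1, y.2.1] = '[adj F (d h), d w].
  rewrite innerC (l2_inner_single y.2.1 (m := 0%N)) => [|[//|j] _].
    by rewrite -innerC y2 t2.
  by rewrite dilation_T_forward adjbE !bounded0 addr0.
rewrite dilation_space_inner T2 inner0l addr0 T1 e1 y1 (adjPl F) closed_range_innerE.
by rewrite (sD h) -fF innerBr -adjP addrC subrK.
Qed.

End schaeffer.

(** The defining inequality for the polynomial [f (s, p) = p]. *)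
Lemma gamma_contraction_norm (R : realType) (H : hilbertType R) (S P : {bounded H -> H}) :
  gamma_contraction S P -> forall x, rnorm (P x) <= rnorm x.
Proof.
move=> [_ /(_ ('X%:P)) hop] x.
have opE : poly2_op ('X%:P) S P = P.
  apply/funext => z; rewrite /poly2_op size_polyC polyX_eq0 /= big_ord1 coefC /=.
  rewrite size_polyX big_ord_recl big_ord1 /= !coefX /=.
  by rewrite scale0r add0r scale1r.
rewrite opE in hop.
have P1 z : rnorm z <= 1 -> rnorm (P z) <= 1.
  move=> z1; apply: (@le_trans _ _ (opnorm P)).
    have [c c0 Pc] := bounded_bound P.
    apply: ub_le_sup; last by exists z.
    exists c => _ [u u1 <-]; apply: (le_trans (Pc u)); rewrite -[leRHS]mulr1.
    by rewrite ler_wpM2l.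
  apply: (le_trans hop); apply: ge_sup.
    exists (Re `|('X%:P : {poly {poly R[i]}}).[0, 0]|), (0, 0) => //.
    by exists (0, 0); rewrite /= ?normr0 ?ler01 ?addr0 ?mul0r.
  move=> _ [_ [[z1' z2'] /= [h1 h2] <-] <-] /=.
  rewrite hornerC hornerX -lecR -cmodE normrM.
  by rewrite mulr_ile1.
have [->|/eqP/rnorm_gt0 x0] := eqVneq x 0; first by rewrite bounded0 rnorm0.
have := P1 ((rnorm x)^-1%:C *: x).
rewrite boundedZ !rnormZr gtr0_norm ?invr_gt0// mulVf ?gt_eqF// => /(_ (lexx _)).
by rewrite ler_pdivrMl// mulr1.
Qed.

Theorem theorem5 (R : realType) (H : hilbertType R) (S P : {bounded H -> H})
    (F : {bounded defect_space P -> defect_space P})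
    (G : {bounded codefect_space P -> codefect_space P})
    (T U : {bounded dilation_space P -> dilation_space P}) :
  gamma_contraction S P ->
  fundamental_op S F ->
  cofundamental_op S G ->
  is_dilation_U U ->
  is_dilation_R S F G T ->
  (forall T' : {bounded dilation_space P -> dilation_space P},
    gamma_unitary_dilation (@embed R H P) S P T' U -> T' =1 T) /\
  (forall (K : hilbertType R) (J : {bounded H -> K}) (T' U' : {bounded K -> K}),
    (forall h, `|J h| = `|h|) ->
    gamma_unitary_dilation J S P T' U' ->
    minimal_unitary_dilation J P U' ->
    unitarily_equivalent T' U' T U).
Proof.
move=> gSP fF fG hU hT; have cP := gamma_contraction_norm gSP; have [SP _] := gSP.
have mT := schaeffer_model cP hU SP fF fG hT.
have tU := dilation_U_minimal cP hU.
split=> [T' dil|K J T' U' iJ dil [[uU' _] minU']].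
  apply: (model_unique mT _ tU).
  exact: (dilation_is_model (J := embed_op P) SP (embed_norm P) (dilation_U_unitary cP hU) dil).
have iJ' h : rnorm (J h) = rnorm h by rewrite /rnorm iJ.
apply: (model_equivalence mT (dilation_is_model SP iJ' uU' dil) tU).
move=> x hx; apply: (closed_span_total minU') => _ [n [h ->]].
exact: (hx (n, h)).
Qed.
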